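(* Let $\mathfrak g=\mathfrak{osp}(m|2n)$, $m,n\ge1$, $r=\lfloor m/2\rfloor$, and let $L(\Lambda;\Delta_A^+)\cong\Pi^{\epsilon}L(\Lambda';\Delta_B^+)$ be a unitary highest weight representation with respect to a conjugate-linear anti-involution $\omega$. First, assume that $\Delta_A^+$ is $\omega$-adapted with sign $\varepsilon$. Then, for every $\mathfrak g_{\bar0}$-highest weight $\mu$ occurring in the $\mathfrak g_{\bar0}$-decomposition of $L(\Lambda';\Delta_B^+)$, one has $$-\varepsilon\Bigl(-(\Lambda'+2\rho^B,\Lambda')+(\mu+2\rho^B,\mu)+2\sum_{i=1}^{r}\sum_{a=1}^{n}(\mu,\epsilon_i-\delta_a)\Bigr)\ge0 .$$ Moreover, the inequality is strict for all $\mathfrak g_{\bar0}$-constituents of highest weight $\mu\ne\Lambda$. Conversely, assume that $\Delta_B^+$ is $\omega$-adapted with sign $\varepsilon$. Then, for every $\mathfrak g_{\bar0}$-highest weight $\mu$ occurring in the $\mathfrak g_{\bar0}$-decomposition of $L(\Lambda;\Delta_A^+)$, one has $$-\varepsilon\Bigl(-(\Lambda+2\rho^A,\Lambda)+(\mu+2\rho^A,\mu)-2\sum_{i=1}^{r}\sum_{a=1}^{n}(\mu,\epsilon_i-\delta_a)\Bigr)\ge0 .$$ Moreover, the inequality is strict for all $\mathfrak g_{\bar0}$-constituents of highest weight $\mu\ne\Lambda'$.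
   Context: With $\Omega_n=\begin{pmatrix}0&I_n\\-I_n&0\end{pmatrix}$, the complex Lie superalgebra $\mathfrak{osp}(m|2n)$ consists of the block matrices $\begin{pmatrix}A&B\\C&D\end{pmatrix}\in\mathfrak{gl}(m|2n)$ with $A=-A^T$, $D=\Omega_nD^T\Omega_n$, $C=-\Omega_nB^T$; $(X,Y)=\frac12\mathrm{str}(XY)$, which induces the form $(\cdot,\cdot)$ on $\mathfrak h^*$. The Cartan subalgebra $\mathfrak h$ consists of $H=\mathrm{diag}(t_1K,\dots,t_rK,0_{m-2r},i\Omega_n\mathrm{diag}(D,D))$ with $K=\begin{pmatrix}0&i\\-i&0\end{pmatrix}$, $D=\mathrm{diag}(d_1,\dots,d_n)$; $\epsilon_i(H)=t_i$, $\delta_a(H)=d_a$. Even positive roots: $\Delta_{\bar0}^+=\{\delta_a\pm\delta_b\ (a<b),\ 2\delta_a,\ \epsilon_i\pm\epsilon_j\ (i<j)\}$, together with $\{\epsilon_i\}$ if $m$ is odd. $\Delta_A^+=\Delta_{\bar0}^+\sqcup\{\delta_a\pm\epsilon_i:1\le a\le n,1\le i\le r\}$ and $\Delta_B^+=\Delta_{\bar0}^+\sqcup\{\epsilon_i\pm\delta_a:1\le i\le r,1\le a\le n\}$, in both cases together with $\{\delta_a:1\le a\le n\}$ if $m$ is odd. For a positive system, $\rho=\frac12\sum_{\alpha\in\Delta_{\bar0}^+}\alpha-\frac12\sum_{\alpha\in\Delta_{\bar1}^+}\alpha$; $\rho^A,\rho^B$ are the Weyl vectors of $\Delta_A^+,\Delta_B^+$.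 $L(\Lambda;\Delta^+)$ is the simple highest weight representation; $\Pi$ is parity reversal; $\epsilon\in\{0,1\}$. For each $\Lambda$ there is a unique $\Lambda'$ with $L(\Lambda;\Delta_A^+)\cong L(\Lambda';\Delta_B^+)$ up to parity. $\omega$ is given by $\omega(X)=J^{-1}\overline X^{\,t}J$ with $J=\mathrm{diag}(\pm I_m,i\Omega_n)$, or, if $m=2r$, $J=\mathrm{diag}(i\bigoplus_{i=1}^r\Omega_1,\pm I_{2n})$. With $\mathfrak n_{\bar1}^\pm=\bigoplus_{\alpha\in\Delta_{\bar1}^+}\mathfrak g^{\pm\alpha}$, $\Delta^+$ is $\omega$-adapted with sign $\varepsilon\in\{\pm1\}$ if there are bases $\{\partial_i\}$ of $\mathfrak n_{\bar1}^+$ and $\{x_i\}$ of $\mathfrak n_{\bar1}^-$ with $(\partial_i,x_j)=\delta_{ij}$ and $\omega(x_i)=\varepsilon\partial_i$ for all $i,j$. A representation is unitary if it carries a positive definite Hermitian form with even and odd part orthogonal and $\langle Xv,w\rangle=\langle v,\omega(X)w\rangle$. The restriction of a unitary highest weight representation to $\mathfrak g_{\bar0}$ is a direct sum of simple highest weight $\mathfrak g_{\bar0}$-modules with respect to $\Delta_{\bar0}^+$; these are its $\mathfrak g_{\bar0}$-constituents. *)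

(* Defs.v *)
From HB Require Import structures.
From mathcomp Require Import all_boot all_order all_algebra.
From mathcomp Require Export reals complex.

Set Implicit Arguments.
Unset Strict Implicit.
Unset Printing Implicit Defensive.

Import Order.TTheory GRing.Theory Num.Theory.
Local Open Scope ring_scope.

Section OspAlgebra.
Variables (C : numClosedFieldType) (m n : nat).

Local Notation r := (m./2).
Local Notation gl := 'M[C]_(m + (n + n)).

Definition Omega : 'M[C]_(n + n) := block_mx 0 1%:M (- 1%:M) 0.

Definition in_osp (X : gl) : Prop :=
  [/\ ulsubmx X = - (ulsubmx X)^T,
      drsubmx X = Omega *m (drsubmx X)^T *m Omega &
      dlsubmx X = - (Omega *m (ursubmx X)^T)].

(* [osp false] is the even part of osp(m|2n) and [osp true] its odd part. *)
Definition osp (p : bool) (X : gl) : Prop :=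
  in_osp X /\ (if p then ulsubmx X = 0 /\ drsubmx X = 0
               else ursubmx X = 0 /\ dlsubmx X = 0).

(* Superbracket of X of parity p with Y of parity q. *)
Definition sbracket (p q : bool) (X Y : gl) : gl :=
  X *m Y - (-1) ^+ (p && q) *: (Y *m X).

Definition str (X : gl) : C := \tr (ulsubmx X) - \tr (drsubmx X).

Definition sform (X Y : gl) : C := 2^-1 * str (X *m Y).

(* The i-th copy of Omega_1 on the diagonal of an m x m matrix, so that
   K = 'i *: Omega_1. *)
Definition Omega1 (i : 'I_r) : 'M[C]_m :=
  \matrix_(p, q) (((p == i.*2 :> nat) && (q == i.*2.+1 :> nat))%:R
                  - ((p == i.*2.+1 :> nat) && (q == i.*2 :> nat))%:R).

(* The element H of the Cartan subalgebra whose coordinates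
   (t_1, ..., t_r, d_1, ..., d_n) form the row h. *)
Definition cartan (h : 'rV[C]_(r + n)) : gl :=
  block_mx (\sum_(i < r) lsubmx h 0 i *: ('i *: Omega1 i)) 0
           0 ('i *: (Omega *m block_mx (diag_mx (rsubmx h)) 0
                                       0 (diag_mx (rsubmx h)))).

(* A weight is the row of its coordinates in the basis
   (eps_1, ..., eps_r, delta_1, ..., delta_n) of the dual of the Cartan
   subalgebra; this is the dual basis of the coordinates of [cartan]. *)
Local Notation wt := 'rV[C]_(r + n).

Definition weval (l h : wt) : C := (l *m h^T) 0 0.

Definition epsw (i : 'I_r) : wt := delta_mx 0 (lshift n i).
Definition deltaw (a : 'I_n) : wt := delta_mx 0 (rshift r a).

(* The form induced on weights: inverse of the Gram matrix of [sform] on the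
   Cartan subalgebra, in the coordinates of [cartan]. The Gram matrix is
   diag(1, ..., 1, -1, ..., -1), so (eps_i, eps_j) = delta_ij and
   (delta_a, delta_b) = - delta_ab. *)
Definition cartan_gram : 'M[C]_(r + n) :=
  \matrix_(k, l) sform (cartan (delta_mx 0 k)) (cartan (delta_mx 0 l)).

Definition wform (l mu : wt) : C := (l *m invmx cartan_gram *m mu^T) 0 0.

Definition even_pos : seq wt :=
     [seq deltaw p.1 - deltaw p.2 | p in [pred p : 'I_n * 'I_n | (p.1 < p.2)%N]]
  ++ [seq deltaw p.1 + deltaw p.2 | p in [pred p : 'I_n * 'I_n | (p.1 < p.2)%N]]
  ++ [seq 2 *: deltaw a | a : 'I_n]
  ++ [seq epsw p.1 - epsw p.2 | p in [pred p : 'I_r * 'I_r | (p.1 < p.2)%N]]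
  ++ [seq epsw p.1 + epsw p.2 | p in [pred p : 'I_r * 'I_r | (p.1 < p.2)%N]]
  ++ (if odd m then [seq epsw i | i : 'I_r] else [::]).

(* The positive systems Delta_A^+ and Delta_B^+ share [even_pos]; they are
   represented by their odd parts. *)
Definition odd_posA : seq wt :=
     [seq deltaw p.1 - epsw p.2 | p : 'I_n * 'I_r]
  ++ [seq deltaw p.1 + epsw p.2 | p : 'I_n * 'I_r]
  ++ (if odd m then [seq deltaw a | a : 'I_n] else [::]).

Definition odd_posB : seq wt :=
     [seq epsw p.1 - deltaw p.2 | p : 'I_r * 'I_n]
  ++ [seq epsw p.1 + deltaw p.2 | p : 'I_r * 'I_n]
  ++ (if odd m then [seq deltaw a | a : 'I_n] else [::]).

Definition rho (D1 : seq wt) : wt :=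
  2^-1 *: (\sum_(al <- even_pos) al) - 2^-1 *: (\sum_(al <- D1) al).

(* The Cartan subalgebra is even, so the superbracket with it is the
   commutator. *)
Definition root_space (al : wt) (X : gl) : Prop :=
  in_osp X /\ forall h, cartan h *m X - X *m cartan h = weval al h *: X.

Definition sum_root_spaces (D : seq wt) (X : gl) : Prop :=
  exists2 Y : wt -> gl, (forall al, al \in D -> root_space al (Y al))
                      & X = \sum_(al <- D) Y al.

Definition is_basis (S : gl -> Prop) (e : seq gl) : Prop :=
  free e /\ forall X, S X <-> X \in <<e>>%VS.

Definition omega (J X : gl) : gl :=
  invmx J *m (map_mx Num.conj X)^T *m J.

Definition anti_involution_matrix (J : gl) : Prop :=
  (exists s : bool, J = block_mx ((-1) ^+ s)%:M 0 0 ('i *: Omega))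
  \/ (~~ odd m /\
      exists s : bool,
        J = block_mx ('i *: \sum_(i < r) Omega1 i) 0 0 ((-1) ^+ s)%:M).

(* The positive system with odd part D1 is adapted to om with sign
   (-1) ^+ s. *)
Definition adapted (om : gl -> gl) (D1 : seq wt) (s : bool) : Prop :=
  exists (N : nat) (d x : N.-tuple gl),
    [/\ is_basis (sum_root_spaces D1) d,
        is_basis (sum_root_spaces [seq - al | al <- D1]) x,
        forall i j, sform (tnth d i) (tnth x j) = (i == j)%:R &
        forall i, om (tnth x i) = (-1) ^+ s *: tnth d i].

End OspAlgebra.

Section OspRep.
Variables (C : numClosedFieldType) (m n : nat).

Local Notation r := (m./2).
Local Notation gl := 'M[C]_(m + (n + n)).
Local Notation wt := 'rV[C]_(r + n).

Definition subspace (V : lmodType C) (W : V -> Prop) : Prop :=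
  W 0 /\ forall (a : C) u v, W u -> W v -> W (a *: u + v).

(* [rep_part false] and [rep_part true] are the even and odd parts; the values
   of [rep_act] outside osp(m|2n) are irrelevant. *)
Record ospRep : Type := OspRep {
  rep_car :> lmodType C;
  rep_part : bool -> rep_car -> Prop;
  rep_act : gl -> rep_car -> rep_car;
  rep_part_sub : forall p, subspace (rep_part p);
  rep_part_add : forall v, exists v0 v1,
    [/\ rep_part false v0, rep_part true v1 & v = v0 + v1];
  rep_part_cap : forall v, rep_part false v -> rep_part true v -> v = 0;
  rep_act_lin : forall X, in_osp X -> linear (rep_act X);
  rep_act_linl : forall (a : C) X Y v, in_osp X -> in_osp Y ->
    rep_act (a *: X + Y) v = a *: rep_act X v + rep_act Y v;
  rep_act_part : forall p q X v, osp p X -> rep_part q v ->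
    rep_part (p (+) q) (rep_act X v);
  rep_act_bracket : forall p q X Y v, osp p X -> osp q Y ->
    rep_act (sbracket p q X Y) v =
      rep_act X (rep_act Y v) - (-1) ^+ (p && q) *: rep_act Y (rep_act X v)
}.

Lemma parity_rev_add (V : ospRep) (v : V) : exists v0 v1,
  [/\ rep_part (~~ false) v0, rep_part (~~ true) v1 & v = v0 + v1].
Proof.
by have [v0 [v1 [h0 h1 ->]]] := rep_part_add v; exists v1, v0; rewrite addrC.
Qed.

Lemma parity_rev_act (V : ospRep) p q X (v : V) :
  osp p X -> rep_part (~~ q) v -> rep_part (~~ (p (+) q)) (rep_act X v).
Proof. by move=> hX hv; rewrite -addbN; apply: rep_act_part. Qed.

(* Parity reversal Pi: the same action on the space with exchanged parts. (The
   variant with X acting on Pi V by (-1)^|X| X is isomorphic to it, through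
   v |-> (-1)^|v| v.) *)
Definition parity_rev (V : ospRep) : ospRep :=
  @OspRep V (fun p => @rep_part V (~~ p)) (@rep_act V)
    (fun p => rep_part_sub V (~~ p)) (@parity_rev_add V)
    (fun v h0 h1 => rep_part_cap h1 h0) (@rep_act_lin V) (@rep_act_linl V)
    (@parity_rev_act V) (@rep_act_bracket V).

(* Isomorphism of representations by an even map. *)
Definition rep_iso (V W : ospRep) : Prop :=
  exists f : {linear V -> W},
    [/\ bijective f, (forall p v, rep_part p v -> rep_part p (f v))
      & forall X v, in_osp X -> f (rep_act X v) = rep_act X (f v)].

Definition submodule (V : ospRep) (G : gl -> Prop) (W : V -> Prop) : Prop :=
  subspace W /\ forall X v, G X -> W v -> W (rep_act X v).

Definition graded (V : ospRep) (W : V -> Prop) : Prop :=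
  forall v, W v -> exists v0 v1,
    [/\ W v0 /\ rep_part false v0, W v1 /\ rep_part true v1 & v = v0 + v1].

Definition simple_rep (V : ospRep) : Prop :=
  (exists v : V, v <> 0) /\
  forall W : V -> Prop, submodule (@in_osp C m n) W -> graded W ->
    (forall v, W v -> v = 0) \/ (forall v, W v).

(* v is a singular vector of weight l for the set D of positive roots. *)
Definition singular (V : ospRep) (D : seq wt) (l : wt) (v : V) : Prop :=
  [/\ v <> 0,
      forall h, rep_act (cartan h) v = weval l h *: v &
      forall al X, al \in D -> root_space al X -> rep_act X v = 0].

(* V is the simple highest weight representation L(l; Delta^+), where D1 is the
   odd part of Delta^+. The parity of the highest weight vector is not
   prescribed, so that V is determined up to parity reversal. *)
Definition simple_highest_weight (V : ospRep) (l : wt) (D1 : seq wt) : Prop :=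
  simple_rep V /\
  exists p (v : V),
    [/\ rep_part p v, singular (even_pos C m n ++ D1) l v &
        forall W : V -> Prop,
          submodule (@in_osp C m n) W -> graded W -> W v -> forall u, W u].

Definition unitary (om : gl -> gl) (V : ospRep) : Prop :=
  exists f : {dot V for Num.conj},
    (forall v w, rep_part false v -> rep_part true w -> f v w = 0) /\
    (forall X v w, in_osp X -> f (rep_act X v) w = f v (rep_act (om X) w)).

(* W is a simple highest weight submodule, of highest weight mu, of the
   restriction of V to the even part of osp(m|2n). *)
Definition even_simple_highest_weight (V : ospRep) (W : V -> Prop) (mu : wt)
    : Prop :=
  [/\ submodule (@osp C m n false) W,
      forall U : V -> Prop, submodule (@osp C m n false) U ->
        (forall v, U v -> W v) ->
        (forall v, U v -> v = 0) \/ (forall v, W v -> U v) &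
      exists v : V,
        [/\ W v, singular (even_pos C m n) mu v &
            forall U : V -> Prop, submodule (@osp C m n false) U -> U v ->
              forall u, W u -> U u]].

(* V, restricted to the even part, is the direct sum of the W i. *)
Definition even_decomposition (V : ospRep) (I : eqType) (W : I -> V -> Prop)
    (mu : I -> wt) : Prop :=
  [/\ forall i, even_simple_highest_weight (W i) (mu i),
      forall v : V, exists (s : seq I) (w : I -> V),
        (forall i, W i (w i)) /\ v = \sum_(i <- s) w i &
      forall (s : seq I) (w : I -> V), uniq s -> (forall i, W i (w i)) ->
        \sum_(i <- s) w i = 0 -> forall i, i \in s -> w i = 0].

Definition even_constituent (V : ospRep) (mu : wt) : Prop :=
  exists (I : eqType) (W : I -> V -> Prop) (nu : I -> wt),
    even_decomposition W nu /\ exists i, nu i = mu.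

End OspRep.

(* Main.v *)
Require Import Defs.
From HB Require Import structures.
From mathcomp Require Import all_boot all_order all_algebra.
From mathcomp Require Import reals complex.
From mathcomp Require Import zify ring.

(* Both inequalities are Dirac inequalities. Let C be the quadratic Casimir
   element of osp(m|2n). It acts on a simple module with a highest weight vector
   of weight L for Delta^+ by (L + 2 rho, L), and this scalar does not depend on
   the positive system used to compute it. On a vector v of weight mu killed by
   the even positive root vectors, C acts by (mu + 2 rho, mu) + 2 sum_i x_i d_i,
   where d_i and x_i are dual bases of n_1^+ and n_1^-. If Delta^+ is adapted
   with sign s, then <x_i d_i v, v> = s |d_i v|^2, so s times the difference of
   the two scalars is nonnegative. It vanishes only if all d_i v = 0; then v is a
   highest weight vector for Delta^+, and its weight is L. Computing the scalar
   with the other positive system, and using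
   rho^A - rho^B = sum_{i,a} (eps_i - delta_a), gives the statement. *)

Set Implicit Arguments.
Unset Strict Implicit.
Unset Printing Implicit Defensive.

Import Order.TTheory GRing.Theory Num.Theory.
Local Open Scope ring_scope.

(** * Weight vectors of the natural representation *)

(** The computations use the redundant family [F p q = E p q - sigma (E p q)], the images in
    osp(m|2n) of the matrix units of a Cartan eigenbasis. Bracketing with [Z] acts on [F] through
    the matrix entries of [Z], as in gl(m|2n), so the invariance of the Casimir element becomes an
    exchange of summation indices. The price is that [F p q] and [F (cj q) (cj p)] are proportional:
    every root is met twice, the operator [casimir] is 2 C, and factors 2 and 4 appear throughout.
    Both positive systems are handled by one argument, through a height on the labels depending on a
    boolean [d] ([false] for A, [true] for B). The obstacle on the module side is that no weight
    decomposition of [V] is given, and that simplicity speaks of graded submodules only. The Casimir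
    scalar is therefore obtained from an eigenspace, which is a graded submodule. That highest
    weights are unique is obtained by lowering a homogeneous highest weight vector and separating
    weights with products of operators h - c. *)

Section Weights.
Variables (C : numClosedFieldType) (m n : nat).

Local Notation r := (m./2).
Local Notation gl := 'M[C]_(m + (n + n)).
Local Notation wt := 'rV[C]_(r + n).

(* Labels of an eigenbasis [ebasis p] of C^(m|2n) under the Cartan subalgebra, of
   weights eps_i, -eps_i, 0 (present if m is odd), delta_a, -delta_a; [cj]
   reverses the sign of the weight. *)
Definition idx : finType := ('I_r + 'I_r + 'I_(odd m) + ('I_n + 'I_n))%type.

Definition par (p : idx) : bool := if p is inr _ then true else false.

Definition cj (p : idx) : idx :=
  match p with
  | inl (inl (inl i)) => inl (inl (inr i))
  | inl (inl (inr i)) => inl (inl (inl i))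
  | inl (inr k) => inl (inr k)
  | inr (inl a) => inr (inr a)
  | inr (inr a) => inr (inl a)
  end.

(* The invariant form pairs [ebasis (cj p)] with [ebasis p] to [sg p]. *)
Definition sg (p : idx) : C := if p is inr (inr _) then -1 else 1.

Definition lam (p : idx) : wt :=
  match p with
  | inl (inl (inl i)) => epsw C n i
  | inl (inl (inr i)) => - epsw C n i
  | inl (inr k) => 0
  | inr (inl a) => deltaw C m a
  | inr (inr a) => - deltaw C m a
  end.

Lemma dbl_subproof (i : 'I_r) : (i.*2 < m)%N.
Proof. by have := ltn_ord i; lia. Qed.
Lemma dblS_subproof (i : 'I_r) : (i.*2.+1 < m)%N.
Proof. by have := ltn_ord i; lia. Qed.
Lemma last_subproof (k : 'I_(odd m)) : (m.-1 < m)%N.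
Proof. by have := ltn_ord k; lia. Qed.
Definition dbl i := Ordinal (dbl_subproof i).
Definition dblS i := Ordinal (dblS_subproof i).
Definition lasto k := Ordinal (last_subproof k).

Definition ovec (x y : C) (i : 'I_r) : 'cV[C]_m :=
  x *: delta_mx (dbl i) 0 + y *: delta_mx (dblS i) 0.

Definition svec (x y : C) (a : 'I_n) : 'cV[C]_(n + n) :=
  col_mx (x *: delta_mx a 0) (y *: delta_mx a 0).

(** Vectors of opposite weights are scaled unequally, the factor 1/2 lying on one of them only, so
    that they pair to [1] or [-1] without square roots. *)
Definition ebasis (p : idx) : 'cV[C]_(m + (n + n)) :=
  match p with
  | inl (inl (inl i)) => col_mx (ovec 2^-1 (- 'i / 2) i) 0
  | inl (inl (inr i)) => col_mx (ovec 1 'i i) 0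
  | inl (inr k) => col_mx (delta_mx (lasto k) 0) 0
  | inr (inl a) => col_mx 0 (svec ('i / 2) 2^-1 a)
  | inr (inr a) => col_mx 0 (svec 1 'i a)
  end.

Definition G : gl := block_mx 1%:M 0 0 (Omega C n).

(** The dual basis is written through the form [G], so that the effect of [sigma], the adjoint for
    this form, on the matrix units can be read off. *)
Definition edual (p : idx) : 'rV[C]_(m + (n + n)) := sg p *: ((ebasis (cj p))^T *m G).

Lemma cjK : involutive cj.
Proof. by case=> [[[]|]|[]]. Qed.

Lemma par_cj p : par (cj p) = par p.
Proof. by case: p => [[[]|]|[]]. Qed.

Lemma lam_cj p : lam (cj p) = - lam p.
Proof. by case: p => [[[]|]|[]] *; rewrite /= ?opprK ?oppr0. Qed.

Lemma sg_cj p : sg (cj p) = (-1) ^+ par p * sg p.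
Proof. by case: p => [[[]|]|[]] * /=; ring. Qed.

Lemma sgsg p : sg p * sg p = 1.
Proof. by case: p => [[[]|]|[]] * /=; ring. Qed.

Lemma dbl_eq i j : (dbl i == dbl j) = (i == j).
Proof. by rewrite -!val_eqE /= (inj_eq double_inj). Qed.
Lemma dblS_eq i j : (dblS i == dblS j) = (i == j).
Proof. by rewrite -!val_eqE /= eqSS (inj_eq double_inj). Qed.
Lemma dbl_dblS i j : (dbl i == dblS j) = false.
Proof. by rewrite -!val_eqE /=; apply/eqP; lia. Qed.
Lemma dblS_dbl i j : (dblS i == dbl j) = false.
Proof. by rewrite -!val_eqE /=; apply/eqP; lia. Qed.
Lemma dbl_last i j : (dbl i == lasto j) = false.
Proof. by rewrite -!val_eqE /=; apply/eqP; have := ltn_ord i; have := ltn_ord j; lia. Qed.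
Lemma dblS_last i j : (dblS i == lasto j) = false.
Proof. by rewrite -!val_eqE /=; apply/eqP; have := ltn_ord i; have := ltn_ord j; lia. Qed.
Lemma last_dbl i j : (lasto j == dbl i) = false.
Proof. by rewrite eq_sym dbl_last. Qed.
Lemma last_dblS i j : (lasto j == dblS i) = false.
Proof. by rewrite eq_sym dblS_last. Qed.
Lemma last_last i j : (lasto i == lasto j) = (i == j).
Proof.
rewrite -!val_eqE /= eqxx; apply/esym/eqP.
by have := ltn_ord i; have := ltn_ord j; lia.
Qed.
Definition ordE := (dbl_eq, dblS_eq, dbl_dblS, dblS_dbl, dbl_last, dblS_last,
  last_dbl, last_dblS, last_last).

Lemma gram_oo (u v : 'cV[C]_m) :
  (col_mx u 0)^T *m G *m col_mx v 0 = u^T *m v.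
Proof.
by rewrite tr_col_mx mul_row_block mul_row_col trmx0 !(mulmx0, mul0mx, addr0) mulmx1.
Qed.
Lemma gram_os (u : 'cV[C]_m) (w : 'cV[C]_(n + n)) :
  (col_mx u 0)^T *m G *m col_mx 0 w = 0.
Proof.
by rewrite tr_col_mx mul_row_block mul_row_col trmx0 !(mulmx0, mul0mx, addr0).
Qed.
Lemma gram_so (u : 'cV[C]_m) (w : 'cV[C]_(n + n)) :
  (col_mx 0 w)^T *m G *m col_mx u 0 = 0.
Proof.
by rewrite tr_col_mx mul_row_block mul_row_col trmx0 !(mulmx0, mul0mx, addr0).
Qed.
Lemma gram_ss (x y z w : C) (a c : 'I_n) :
  (col_mx 0 (svec x y a))^T *m G *m col_mx 0 (svec z w c) =
  ((x * w - y * z) * (a == c)%:R)%:M.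
Proof.
rewrite tr_col_mx mul_row_block mul_row_col trmx0 !(mulmx0, mul0mx, add0r).
rewrite tr_col_mx mul_row_block mul_row_col !(mulmx0, add0r, addr0, mulmx1).
rewrite mulmxN mulmx1 !linearZ /= -!(scalemxAl, scalemxAr) ?mulNmx.
rewrite !trmx_delta !mul_delta_mx_cond.
apply/matrixP=> i j; rewrite !ord1; case: (a == c); rewrite !mxE /= ?mulr1n ?mulr0n; ring.
Qed.
Lemma gram_dd (i j : 'I_m) :
  (delta_mx i 0)^T *m delta_mx j 0 = (i == j)%:R%:M :> 'M[C]_1.
Proof.
rewrite trmx_delta mul_delta_mx_cond -scaler_nat.
by apply/matrixP=> x y; rewrite !ord1 !mxE eqxx mulr1.
Qed.
Lemma gram_ov (x y z w : C) (i j : 'I_r) :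
  (ovec x y i)^T *m ovec z w j = ((x * z + y * w) * (i == j)%:R)%:M.
Proof.
rewrite /ovec [(_ + _)^T]linearD /= ![(_ *: _)^T]linearZ /= mulmxDl !mulmxDr
  -!(scalemxAl, scalemxAr).
rewrite !gram_dd !ordE.
apply/matrixP=> k l; rewrite !ord1 !mxE /= !mulr1n; ring.
Qed.
Lemma gram_od (x y : C) (i : 'I_r) j :
  (ovec x y i)^T *m delta_mx (lasto j) 0 = 0 :> 'M_1.
Proof.
rewrite /ovec [(_ + _)^T]linearD /= ![(_ *: _)^T]linearZ /= mulmxDl -!scalemxAl
  !gram_dd !ordE.
by rewrite raddf0 !scaler0 addr0.
Qed.
Lemma gram_do (x y : C) (i : 'I_r) j :
  (delta_mx (lasto j) 0)^T *m ovec x y i = 0 :> 'M_1.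
Proof. by rewrite -[RHS]trmx0 -(gram_od x y i j) trmx_mul trmxK. Qed.

Lemma edual_ebasis p q : edual p *m ebasis q = (p == q)%:R%:M.
Proof.
have iic : 'i * 'i = -1 :> C by rewrite -expr2 sqrCi.
rewrite /edual -scalemxAl.
case: p q => [[[i|i]|i]|[i|i]] [[[j|j]|j]|[j|j]] /=;
  rewrite ?(gram_oo, gram_os, gram_so, gram_ss) ?(gram_dd, gram_od, gram_do, gram_ov);
  rewrite ?scaler0 ?ordE ?scale_scalar_mx -?[LHS](raddf0 (@scalar_mx C 1)); congr _%:M.
all: rewrite /eq_op /= ?(mul1r, mulN1r) //.
all: set t := (_ == _)%:R.
all: by field: iic.
Qed.
End Weights.
Arguments cjK {m n} _.

(** * Matrix units and coefficients in the eigenbasis *)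

Section Units.
Variables (C : numClosedFieldType) (m n : nat).

Local Notation r := (m./2).
Local Notation gl := 'M[C]_(m + (n + n)).
Local Notation wt := 'rV[C]_(r + n).
Local Notation idx := (idx m n).
Local Notation ebasis := (@ebasis C m n).
Local Notation edual := (@edual C m n).
Local Notation lam := (@lam C m n).
Local Notation Om := (Omega C n).

(* [E] and [ecoef] are locked: unification would otherwise unfold them down to
   sums of matrix entries. *)
Fact E_key : unit. Proof. by []. Qed.
Definition E : idx -> idx -> gl := locked_with E_key (fun p q => ebasis p *m edual q).
Lemma E_def p q : E p q = ebasis p *m edual q.
Proof. by rewrite /E unlock. Qed.

Fact ecoef_key : unit. Proof. by []. Qed.
Definition ecoef : gl -> idx -> idx -> C :=
  locked_with ecoef_key (fun X p q => (edual p *m X *m ebasis q) 0 0).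
Lemma ecoef_def X p q : ecoef X p q = (edual p *m X *m ebasis q) 0 0.
Proof. by rewrite /ecoef unlock. Qed.

Lemma card_idx : #|idx| = (m + (n + n))%N.
Proof. by rewrite !card_sum !card_ord; have := odd_double_half m; lia. Qed.

(** Duality says that [Q *m P] is the identity; both matrices are square because there are m + 2n
    labels, so [P *m Q] is the identity as well, which is completeness. *)
Lemma sum_E : \sum_p E p p = 1%:M.
Proof.
pose e (k : 'I_(m + (n + n))) : idx := enum_val (cast_ord (esym card_idx) k).
pose P : gl := \matrix_(x, k) ebasis (e k) x 0.
pose Q : gl := \matrix_(k, x) edual (e k) 0 x.
have ei : injective e by move=> x y /enum_val_inj/cast_ord_inj.
have QP : Q *m P = 1%:M.
  apply/matrixP=> k l; have /matrixP/(_ 0 0) := edual_ebasis C (e k) (e l).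
  rewrite !mxE (inj_eq ei) mulr1n => <-.
  by apply: eq_bigr => x _; rewrite !mxE.
have eb : bijective e by apply: inj_card_bij => //; rewrite card_idx card_ord.
rewrite -(mulmx1C QP) (reindex e) /=; last exact: onW_bij.
apply/matrixP=> x y; rewrite summxE [RHS]mxE; apply: eq_bigr => k _.
by rewrite !E_def mxE big_ord1 [P _ _]mxE [Q _ _]mxE.
Qed.

Lemma mul_col_expand (X : gl) q : X *m ebasis q = \sum_p ecoef X p q *: ebasis p.
Proof.
rewrite -[LHS]mul1mx -sum_E mulmx_suml; apply: eq_bigr => p _.
rewrite !E_def -mulmxA [edual p *m _]mulmxA [edual p *m X *m ebasis q]mx11_scalar
  -ecoef_def.
by rewrite mul_mx_scalar.
Qed.

Lemma mul_row_expand (X : gl) p : edual p *m X = \sum_q ecoef X p q *: edual q.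
Proof.
rewrite -[LHS]mulmx1 -sum_E mulmx_sumr; apply: eq_bigr => q _.
rewrite !E_def mulmxA [edual p *m X *m ebasis q]mx11_scalar -ecoef_def.
by rewrite mul_scalar_mx.
Qed.

Lemma mulXE X p q : X *m E p q = \sum_s ecoef X s p *: E s q.
Proof.
by rewrite !E_def mulmxA mul_col_expand mulmx_suml; apply: eq_bigr => s _;
  rewrite E_def -scalemxAl.
Qed.

Lemma mulEX X p q : E p q *m X = \sum_s ecoef X q s *: E p s.
Proof.
by rewrite !E_def -mulmxA mul_row_expand mulmx_sumr; apply: eq_bigr => s _;
  rewrite E_def -scalemxAr.
Qed.

Lemma mx_expand X : X = \sum_p \sum_q ecoef X p q *: E p q.
Proof.
rewrite -[LHS]mulmx1 -sum_E mulmx_sumr exchange_big /=.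
by apply: eq_bigr => q _; rewrite mulXE.
Qed.

Lemma ecoefE p q s t : ecoef (E p q) s t = ((s == p) && (q == t))%:R.
Proof.
rewrite ecoef_def E_def mulmxA edual_ebasis mul_scalar_mx -scalemxAl edual_ebasis !mxE
  /= mulr1n.
by case: (s == p); case: (q == t); rewrite ?(mulr1, mulr0, mul0r).
Qed.

Lemma ecoef_linear a X Y p q :
  ecoef (a *: X + Y) p q = a * ecoef X p q + ecoef Y p q.
Proof.
by rewrite !ecoef_def mulmxDr mulmxDl -scalemxAr -scalemxAl !mxE.
Qed.

Lemma ecoef0 p q : ecoef 0 p q = 0.
Proof. by rewrite !ecoef_def mulmx0 mul0mx mxE. Qed.
Lemma ecoefZ a X p q : ecoef (a *: X) p q = a * ecoef X p q.
Proof. by rewrite -[a *: X]addr0 ecoef_linear ecoef0 addr0. Qed.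
Lemma ecoefD X Y p q : ecoef (X + Y) p q = ecoef X p q + ecoef Y p q.
Proof. by rewrite -[X in ecoef (X + _)]scale1r ecoef_linear mul1r. Qed.
Lemma ecoefN X p q : ecoef (- X) p q = - ecoef X p q.
Proof. by rewrite -scaleN1r ecoefZ mulN1r. Qed.
Lemma ecoef_sum (I : Type) (s : seq I) (P : pred I) (X : I -> gl) p q :
  ecoef (\sum_(i <- s | P i) X i) p q = \sum_(i <- s | P i) ecoef (X i) p q.
Proof. by apply: (big_morph (fun X => ecoef X p q)) => [Y Z|];
  rewrite ?ecoefD ?ecoef0. Qed.

Lemma mx_eq_ecoef X Y : (forall p q, ecoef X p q = ecoef Y p q) -> X = Y.
Proof.
move=> h; rewrite (mx_expand X) (mx_expand Y).
by apply: eq_bigr => p _; apply: eq_bigr => q _; rewrite h.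
Qed.

Lemma ecoef_mul X Y p q : ecoef (X *m Y) p q = \sum_s ecoef X p s * ecoef Y s q.
Proof.
rewrite [LHS]ecoef_def mulmxA mul_row_expand !mulmx_suml summxE.
by apply: eq_bigr => s _; rewrite -scalemxAl -scalemxAl mxE [ecoef Y _ _]ecoef_def.
Qed.

Lemma weval_sum (l h : wt) : weval l h = \sum_k l 0 k * h 0 k.
Proof. by rewrite /weval mxE; apply: eq_bigr => k _; rewrite mxE. Qed.

Lemma wevalC (l h : wt) : weval l h = weval h l.
Proof. by rewrite !weval_sum; apply: eq_bigr => k _; rewrite mulrC. Qed.

Lemma wevalDl (l l' h : wt) : weval (l + l') h = weval l h + weval l' h.
Proof. by rewrite /weval mulmxDl mxE. Qed.
Lemma wevalNl (l h : wt) : weval (- l) h = - weval l h.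
Proof. by rewrite /weval mulNmx mxE. Qed.
Lemma wevalBl (l l' h : wt) : weval (l - l') h = weval l h - weval l' h.
Proof. by rewrite wevalDl wevalNl. Qed.
Lemma weval0l (h : wt) : weval 0 h = 0.
Proof. by rewrite /weval mul0mx mxE. Qed.
Lemma weval_eps i (h : wt) : weval (epsw C n i) h = h 0 (lshift n i).
Proof.
rewrite weval_sum (bigD1 (lshift n i)) //= big1 ?addr0 ?mxE ?eqxx ?mul1r //.
by move=> k /negPf hk; rewrite mxE hk andbF mul0r.
Qed.
Lemma weval_delta a (h : wt) : weval (deltaw C m a) h = h 0 (rshift r a).
Proof.
rewrite weval_sum (bigD1 (rshift r a)) //= big1 ?addr0 ?mxE ?eqxx ?mul1r //.
by move=> k /negPf hk; rewrite mxE hk andbF mul0r.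
Qed.
Lemma weval_inj (l l' : wt) : (forall h, weval l h = weval l' h) -> l = l'.
Proof.
move=> h; apply/rowP=> k; have := h (delta_mx 0 k);
  rewrite ![weval _ (delta_mx 0 k)]wevalC.
have aux (x : wt) : weval (delta_mx 0 k) x = x 0 k.
  rewrite weval_sum (bigD1 k) //= big1 ?addr0 ?mxE ?eqxx ?mul1r //.
  by move=> j /negPf hk; rewrite mxE hk andbF mul0r.
by rewrite !aux.
Qed.

Lemma Omega1_ovec (i j : 'I_r) (x y : C) :
  Omega1 C i *m ovec x y j = (i == j)%:R *: ovec y (- x) j.
Proof.
have -> : Omega1 C i = delta_mx (dbl i) (dblS i) - delta_mx (dblS i) (dbl i).
  by apply/matrixP=> p q; rewrite !mxE -!val_eqE.
rewrite /ovec mulmxBl !mulmxDr -!scalemxAr !mul_delta_mx_cond !ordE.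
have [<-|_] := eqVneq i j;
  rewrite ?mulr1n ?mulr0n ?scale1r ?scale0r ?scaler0 ?add0r ?addr0 ?subr0 ?oppr0 //.
by rewrite scaleNr.
Qed.

Lemma Omega_diag_svec (d : 'rV[C]_n) (a : 'I_n) (x y : C) :
  Om *m block_mx (diag_mx d) 0 0 (diag_mx d) *m svec x y a = d 0 a *: svec y (- x) a.
Proof.
have dm : diag_mx d *m delta_mx a 0 = d 0 a *: delta_mx a 0 :> 'cV_n.
  by apply/matrixP=> i j; rewrite mul_diag_mx !mxE; case: eqVneq => [->|];
    rewrite ?andbF //= !mulr0.
rewrite -mulmxA /svec mul_block_col !mul0mx addr0 add0r -!scalemxAr dm.
rewrite mul_block_col !mul0mx addr0 add0r mul1mx mulNmx mul1mx scale_col_mx.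
by rewrite !scalerA !(mulrC (d 0 a)) mulNr scaleNr.
Qed.

Lemma cartan_ebasis (h : wt) p : cartan h *m ebasis p = weval (lam p) h *: ebasis p.
Proof.
have iic : 'i * 'i = -1 :> C by rewrite -expr2 sqrCi.
case: p => [[[j|j]|j]|[a|a]] /=; rewrite ?wevalNl ?weval0l ?weval_eps ?weval_delta;
  rewrite /cartan mul_block_col !(mulmx0, mul0mx, addr0, add0r) scale_col_mx scaler0;
  congr col_mx.
- rewrite mulmx_suml (bigD1 j) //= big1 ?addr0 => [|i /negPf hi]; last first.
    by rewrite -!scalemxAl Omega1_ovec hi scale0r !scaler0.
  rewrite -!scalemxAl Omega1_ovec eqxx scale1r mxE; congr (_ *: _).
  rewrite /ovec scalerDr !scalerA; congr (_ *: _ + _ *: _); by field: iic.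
- rewrite mulmx_suml (bigD1 j) //= big1 ?addr0 => [|i /negPf hi]; last first.
    by rewrite -!scalemxAl Omega1_ovec hi scale0r !scaler0.
  rewrite -!scalemxAl Omega1_ovec eqxx scale1r mxE scaleNr -scalerN; congr (_ *: _).
  rewrite /ovec scalerDr opprD -!scaleNr !scalerA; congr (_ *: _ + _ *: _); by ring: iic.
- rewrite scale0r mulmx_suml big1 // => i _.
  have -> : Omega1 C i = delta_mx (dbl i) (dblS i) - delta_mx (dblS i) (dbl i).
    by apply/matrixP=> p q; rewrite !mxE -!val_eqE.
  by rewrite -!scalemxAl mulmxBl !mul_delta_mx_cond !ordE subrr !scaler0.
- rewrite -scalemxAl Omega_diag_svec mxE scalerA mulrC -scalerA; congr (_ *: _).
  rewrite /svec scale_col_mx !scalerA; congr (col_mx (_ *: _) (_ *: _)); by field: iic.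
- rewrite -scalemxAl Omega_diag_svec mxE scalerA mulrC -scalerA scaleNr -scalerN;
    congr (_ *: _).
  rewrite /svec scale_col_mx opp_col_mx -!scaleNr !scalerA;
    congr (col_mx (_ *: _) (_ *: _)); by ring: iic.
Qed.
End Units.

(** * The superalgebra osp inside gl *)

Section Sigma.
Variables (C : numClosedFieldType) (m n : nat).

Local Notation gl := 'M[C]_(m + (n + n)).
Local Notation idx := (idx m n).
Local Notation ebasis := (@ebasis C m n).
Local Notation edual := (@edual C m n).
Local Notation sg := (@sg C m n).
Local Notation Om := (Omega C n).
Local Notation E := (@E C m n).
Local Notation ecoef := (@ecoef C m n).

(* sigma is the super-antiautomorphism of gl(m|2n) attached to the invariant
   form, so that osp(m|2n) = {X | sigma X = - X}. *)
Definition sigma (X : gl) : gl :=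
  block_mx (ulsubmx X)^T ((dlsubmx X)^T *m Om)
           (Om *m (ursubmx X)^T) (- (Om *m (drsubmx X)^T *m Om)).

Definition homog (p : bool) (X : gl) : Prop :=
  if p then ulsubmx X = 0 /\ drsubmx X = 0
  else ursubmx X = 0 /\ dlsubmx X = 0.

Lemma OmegaT : Om^T = - Om.
Proof.
by rewrite /Omega tr_block_mx !trmx0 trmx1 linearN /= trmx1 opp_block_mx !oppr0 opprK.
Qed.

Lemma Omega2 : Om *m Om = - 1%:M.
Proof.
rewrite /Omega mulmx_block !(mul0mx, mulmx0, add0r, addr0) mul1mx mulmx1.
by rewrite scalar_mx_block opp_block_mx !oppr0.
Qed.

Lemma sigma_linear : linear sigma.
Proof.
move=> a X Y; rewrite -[X]submxK -[Y]submxK /sigma.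
rewrite !(scale_block_mx, add_block_mx, block_mxKul, block_mxKur, block_mxKdl,
  block_mxKdr).
by rewrite !linearP /= !(mulmxDl, =^~ scalemxAl, opprD, scalerN).
Qed.
HB.instance Definition _ := GRing.isLinear.Build C gl gl _ sigma sigma_linear.

Lemma in_ospE X : in_osp X <-> sigma X = - X.
Proof.
have -> : - X = block_mx (- ulsubmx X) (- ursubmx X) (- dlsubmx X) (- drsubmx X).
  by rewrite -opp_block_mx submxK.
rewrite /in_osp /sigma; split.
  case=> h1 h2 h3; congr block_mx.
  - by rewrite [in RHS]h1 opprK.
  - by rewrite h3 linearN /= trmx_mul trmxK OmegaT mulmxN opprK -mulmxA Omega2 mulmxN
      mulmx1.
  - by rewrite [in RHS]h3 opprK.
  - by rewrite [in RHS]h2.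
move=> /eq_block_mx[h1 h2 h3 h4]; split.
- by rewrite h1 opprK.
- by rewrite -[LHS]opprK -h4 opprK.
- by rewrite h3 opprK.
Qed.

Lemma sigmaM (x y : bool) X Y : homog x X -> homog y Y ->
  sigma (X *m Y) = (-1) ^+ (x && y) *: (sigma Y *m sigma X).
Proof.
rewrite -[X]submxK -[Y]submxK.
move: (ulsubmx X) (ursubmx X) (dlsubmx X) (drsubmx X) => A1 B1 C1 D1.
move: (ulsubmx Y) (ursubmx Y) (dlsubmx Y) (drsubmx Y) => A2 B2 C2 D2.
have O2 k (Z : 'M_(_, k)) : Om *m (Om *m Z) = - Z by rewrite mulmxA Omega2 mulNmx mul1mx.
rewrite /homog; case: x; case: y;
  rewrite ?(block_mxKul, block_mxKur, block_mxKdl, block_mxKdr);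
  move=> [-> ->] [-> ->];
  rewrite /sigma mulmx_block !(block_mxKul, block_mxKur, block_mxKdl, block_mxKdr);
  rewrite mulmx_block !(mul0mx, mulmx0, trmx0, add0r, addr0, oppr0) /= ?expr0 ?expr1
    ?scale1r ?scaleN1r ?opp_block_mx;
  congr block_mx; rewrite ?(mul0mx, mulmx0, trmx0, add0r, addr0, oppr0, trmx_mul) //.
all: rewrite -?mulmxA ?(mulNmx, mulmxN, mulmxA, O2, opprK) -?mulmxA ?O2 ?mulmxN ?opprK //.
Qed.

Lemma homogP x a X Y : homog x X -> homog x Y -> homog x (a *: X + Y).
Proof.
rewrite -[X]submxK -[Y]submxK scale_block_mx add_block_mx /homog.
rewrite !(block_mxKul, block_mxKur, block_mxKdl, block_mxKdr).
by case: x => - [-> ->] [-> ->]; rewrite !scaler0 !addr0.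
Qed.

Lemma homog_sigma x X : homog x X -> homog x (sigma X).
Proof.
rewrite /sigma /homog !(block_mxKul, block_mxKur, block_mxKdl, block_mxKdr).
by case: x => - [-> ->]; rewrite !trmx0 ?(mul0mx, mulmx0) ?oppr0.
Qed.

Lemma sigmaK X : sigma (sigma X) = X.
Proof.
rewrite /sigma !(block_mxKul, block_mxKur, block_mxKdl, block_mxKdr).
rewrite -[RHS]submxK [(- _)^T]linearN /= !trmx_mul !trmxK !OmegaT; congr block_mx.
- by rewrite mulmxN mulNmx -mulmxA Omega2 mulmxN mulmx1 opprK.
- by rewrite mulNmx mulmxN mulmxA Omega2 mulNmx mul1mx opprK.
rewrite !(mulNmx, mulmxN, opprK) !mulmxA Omega2 -!mulmxA Omega2.
by rewrite !(mulNmx, mulmxN, opprK) mul1mx mulmx1.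
Qed.

Lemma ebasis_split p : exists u w, ebasis p = col_mx u w /\ (if par p then u = 0 else w
  = 0).
Proof.
by case: p => [[[i|i]|i]|[i|i]] /=; eexists; eexists.
Qed.

Definition sgn2 (p q : idx) : C :=
  (-1) ^+ (par p && par q) * (-1) ^+ par p * sg p * sg q.

Lemma sgn2_sym p q : sgn2 q p = (-1) ^+ (par p (+) par q) * sgn2 p q.
Proof. rewrite /sgn2; case: (par p); case: (par q) => /=; ring. Qed.

Lemma sgn2_sqr p q : sgn2 p q * sgn2 p q = 1.
Proof.
rewrite /sgn2; have := sgsg C p; have := sgsg C q.
move: (sg p) (sg q) => x y hy hx.
case: (par p); case: (par q) => /=; by ring: hx hy.
Qed.

Lemma homog_E p q : homog (par p (+) par q) (E p q).
Proof.
rewrite !E_def /edual; have [u [w [-> hu]]] := ebasis_split p.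
have [v [z [-> hv]]] := ebasis_split (cj q); move: hv; rewrite par_cj.
rewrite /G tr_col_mx mul_row_block scale_row_mx mul_col_row /homog.
rewrite !(block_mxKul, block_mxKur, block_mxKdl, block_mxKdr) => hv.
by move: hu hv; case: (par p); case: (par q) => /= -> ->;
   rewrite ?trmx0 !(mulmx0, mul0mx, addr0, add0r, scaler0).
Qed.

(** Up to [sg q], [E p q] is the rank-one operator built from [ebasis p] and [ebasis (cj q)] through
    the form, and taking adjoints exchanges these two vectors. All signs are collected in [sgn2]. *)
Lemma sigma_E p q : sigma (E p q) = sgn2 p q *: E (cj q) (cj p).
Proof.
rewrite !E_def /edual cjK sg_cj -!scalemxAr linearZ /= scalerA.
suff -> : sigma (ebasis p *m ((ebasis (cj q))^T *m G C m n)) =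
   (-1) ^+ (par p && par q) *: (ebasis (cj q) *m ((ebasis p)^T *m G C m n)).
  rewrite scalerA; congr (_ *: _); rewrite /sgn2.
  have := sgsg C p; move: (sg p) (sg q) => x y hx.
  case: (par p); case: (par q) => /=; by ring: hx.
have [u [w [-> hu]]] := ebasis_split p.
have [v [z [-> hv]]] := ebasis_split (cj q); move: hv; rewrite par_cj.
rewrite /G !tr_col_mx !mul_row_block !mul_col_row /sigma => hv.
rewrite !(block_mxKul, block_mxKur, block_mxKdl, block_mxKdr) scale_block_mx.
move: hu hv; case: (par p); case: (par q) => /= -> ->;
  rewrite !(trmx0, trmx1, mulmx0, mul0mx, addr0, add0r, scaler0, mulmx1, trmx_mul,
    trmxK, oppr0, OmegaT, expr0, scale1r, expr1, scaleN1r) //.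
all: congr block_mx; rewrite ?(mulNmx, mulmxN, opprK) ?mulmxA ?Omega2 ?(mulNmx, mulmxN,
  opprK, mul1mx) ?trmxK //.
Qed.

Fact F_key : unit. Proof. by []. Qed.
(** Twice the projection of [E p q] to osp(m|2n). Since [sigma] is an involution,
    [F p q = - sgn2 p q *: F (cj q) (cj p)]: the family spans but is not free, which the factors 1/2
    in the expansions compensate. *)
Definition F : idx -> idx -> gl :=
  locked_with F_key (fun p q => E p q - sigma (E p q)).
Lemma F_def p q : F p q = E p q - sigma (E p q).
Proof. by rewrite /F unlock. Qed.

Lemma F_E p q : F p q = E p q - sgn2 p q *: E (cj q) (cj p).
Proof. by rewrite F_def sigma_E. Qed.

Lemma osp_F p q : osp (par p (+) par q) (F p q).
Proof.
split; last by rewrite -/(homog _ _) F_def addrC -scaleN1r;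
  apply: homogP (homog_E _ _); apply: homog_sigma (homog_E _ _).
by apply/in_ospE; rewrite F_def raddfB /= sigmaK opprB.
Qed.

Lemma in_osp_F p q : in_osp (F p q).
Proof. by case: (osp_F p q). Qed.

Lemma in_osp_lin a X Y : in_osp X -> in_osp Y -> in_osp (a *: X + Y : gl).
Proof. by rewrite !in_ospE linearP /= => -> ->; rewrite opprD scalerN. Qed.

Lemma in_osp0 : in_osp (0 : gl).
Proof. by rewrite in_ospE linear0 oppr0. Qed.

Lemma in_osp_sum (I : Type) (s : seq I) (P : pred I) (c : I -> C) (X : I -> gl) :
  (forall i, in_osp (X i)) -> in_osp (\sum_(i <- s | P i) c i *: X i).
Proof.
move=> h; elim: s => [|i s IH]; first by rewrite big_nil; apply: in_osp0.
by rewrite big_cons; case: (P i) => //; apply: in_osp_lin.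
Qed.

(** From [sigma X = - X], [X] is half of [X - sigma X]; expanding [X] in matrix units then produces
    the [F p q]. *)
Lemma osp_expand X : in_osp X ->
  X = \sum_p \sum_q (2^-1 * ecoef X p q) *: F p q.
Proof.
move/in_ospE => h.
have {1}-> : X = 2^-1 *: (X - sigma X).
  by rewrite h opprK -mulr2n -scaler_nat scalerA mulVf ?scale1r ?pnatr_eq0.
rewrite {1 2}(mx_expand X) linear_sum -sumrB scaler_sumr; apply: eq_bigr => p _.
rewrite linear_sum -sumrB scaler_sumr; apply: eq_bigr => q _.
by rewrite linearZ -scalerBr scalerA F_def.
Qed.

Lemma osp_ecoef X p q : in_osp X -> ecoef X (cj p) (cj q) = - sgn2 q p * ecoef X q p.
Proof.
move/in_ospE => h; rewrite mulNr -[LHS]opprK; congr (- _).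
have -> : - ecoef X (cj p) (cj q) = ecoef (sigma X) (cj p) (cj q).
  by rewrite h ecoefN.
rewrite [in LHS](mx_expand X) linear_sum /= !ecoef_sum (bigD1 q) //= [X in _ + X]big1
  => [|s /negPf hs]; last first.
  rewrite linear_sum ecoef_sum big1 // => t _.
by rewrite linearZ /= sigma_E !ecoefZ ecoefE !(can_eq cjK) hs andbF !mulr0.
rewrite addr0 linear_sum ecoef_sum (bigD1 p) //= big1 => [|t /negPf ht]; last first.
  by rewrite linearZ /= sigma_E !ecoefZ ecoefE !(can_eq cjK) (eq_sym p) ht !mulr0.
by rewrite addr0 linearZ /= sigma_E !ecoefZ ecoefE !eqxx mulr1 mulrC.
Qed.

Lemma homog_ecoef z X p q : homog z X -> ecoef X p q != 0 -> par p (+) par q = z.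
Proof.
move=> hX; apply: contra_neq_eq => /negP hz.
rewrite !ecoef_def /edual -!scalemxAl mxE.
have [u [w [-> hu]]] := ebasis_split q.
have [v [y [-> hv]]] := ebasis_split (cj p); move: hv; rewrite par_cj => hv.
rewrite -[X]submxK /G tr_col_mx mul_row_block mul_row_block mul_row_col.
move: hX hu hv hz; rewrite /homog; case: z; case: (par p);
  case: (par q) => /= - [hx1 hx2] -> -> //=.
all: rewrite ?hx1 ?hx2 ?trmx0 !(mulmx0, mul0mx, addr0, add0r) ?mxE ?mulr0 //.
Qed.

Lemma sum_ecoefFl Z p q :
  \sum_s ecoef Z s p *: F s q = Z *m E p q - sigma (Z *m E p q).
Proof.
rewrite mulXE linear_sum -sumrB; apply: eq_bigr => s _.
by rewrite linearZ -scalerBr F_def.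
Qed.

Lemma sum_ecoefFr Z p q :
  \sum_s ecoef Z q s *: F p s = E p q *m Z - sigma (E p q *m Z).
Proof.
rewrite mulEX linear_sum -sumrB; apply: eq_bigr => s _.
by rewrite linearZ -scalerBr F_def.
Qed.

(** The map [X - sigma X] commutes with the bracket by an element of osp(m|2n), because [sigma]
    reverses products up to the super sign. Hence [F p q] transforms exactly as [E p q] does in
    gl(m|2n). *)
Lemma sbracketF z Z p q : osp z Z ->
  sbracket z (par p (+) par q) Z (F p q) =
  \sum_s ecoef Z s p *: F s q
  - (-1) ^+ (z && (par p (+) par q)) *: \sum_s ecoef Z q s *: F p s.
Proof.
case=> hZ0 hz.
have hZ := proj1 (in_ospE Z) hZ0.
rewrite sum_ecoefFl sum_ecoefFr.
have hy := homog_E p q.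
set y := par p (+) par q in hy *.
rewrite /sbracket F_def mulmxBr mulmxBl.
have -> : Z *m sigma (E p q) = - ((-1) ^+ (z && y) *: sigma (E p q *m Z)).
  by rewrite (sigmaM hy hz) andbC scalerA -expr2 sqrr_sign scale1r hZ mulNmx opprK.
have e2 : (-1) ^+ (z && y) *: (sigma (E p q) *m Z) = - sigma (Z *m E p q).
  by rewrite (sigmaM hz hy) hZ mulmxN scalerN opprK.
rewrite !scalerBr e2; move: (Z *m E p q) (E p q *m Z) (sigma _) (sigma _) => A B SA SB.
rewrite !opprD !opprK addrACA. rewrite (addrC _ (- SA)) addrACA. by [].
Qed.
End Sigma.

(** * Root vectors and the invariant form *)

Section Cartan.
Variables (C : numClosedFieldType) (m n : nat).

Local Notation r := (m./2).
Local Notation gl := 'M[C]_(m + (n + n)).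
Local Notation wt := 'rV[C]_(r + n).
Local Notation idx := (idx m n).
Local Notation ebasis := (@ebasis C m n).
Local Notation sg := (@sg C m n).
Local Notation lam := (@lam C m n).
Local Notation E := (@E C m n).
Local Notation ecoef := (@ecoef C m n).
Local Notation F := (@F C m n).
Local Notation sgn2 := (@sgn2 C m n).

Lemma sgn2_diag p : sgn2 p p = 1 :> C.
Proof. by rewrite /sgn2 -mulrA sgsg mulr1 -signr_addb andbb addbb. Qed.

Lemma sgn2_cj (p : idx) : sgn2 p (cj p) = (-1) ^+ par p.
Proof.
rewrite /sgn2 par_cj sg_cj andbb -!mulrA [sg p * _]mulrCA sgsg mulr1.
by rewrite mulrA -signr_addb addbb mul1r.
Qed.

Lemma cartanE (h : wt) : cartan h = \sum_p weval (lam p) h *: E p p.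
Proof.
rewrite -[LHS]mulmx1 -sum_E mulmx_sumr; apply: eq_bigr => p _.
by rewrite !E_def mulmxA cartan_ebasis -scalemxAl.
Qed.

Lemma reindex_cj (V : nmodType) (f : idx -> V) : \sum_p f p = \sum_p f (cj p).
Proof. by rewrite (reindex_inj (inv_inj cjK)). Qed.

Lemma cartan_F (h : wt) : cartan h = \sum_p (2^-1 * weval (lam p) h) *: F p p.
Proof.
under eq_bigr do rewrite -scalerA F_E sgn2_diag scale1r scalerBr.
rewrite -scaler_sumr sumrB -cartanE.
under eq_bigr do rewrite -[weval _ _]opprK -wevalNl -lam_cj scaleNr.
rewrite -(reindex_cj (fun p => - (weval (lam p) h *: E p p))) sumrN opprK -cartanE.
by rewrite -mulr2n -scaler_nat scalerA mulVf ?scale1r ?pnatr_eq0.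
Qed.

Lemma osp_cartan (h : wt) : osp false (cartan h).
Proof.
split; last by rewrite /cartan block_mxKur block_mxKdl.
by rewrite cartan_F; apply: in_osp_sum => p; apply: in_osp_F.
Qed.

Lemma ecoef_cartan (h : wt) p q : ecoef (cartan h) p q = (p == q)%:R * weval (lam q) h.
Proof.
by rewrite !ecoef_def -mulmxA cartan_ebasis -scalemxAr mxE edual_ebasis mxE eqxx mulr1n
  mulrC.
Qed.

Lemma weval_lam p q : weval (lam p) (lam q) = (p == q)%:R - (p == cj q)%:R :> C.
Proof.
case: p q => [[[i|i]|i]|[i|i]] [[[j|j]|j]|[j|j]];
 rewrite /= ?wevalNl ?weval0l ?weval_eps ?weval_delta ?mxE ?eqxx ?(inj_eq (@lshift_inj
   _ _))
   ?(inj_eq (@rshift_inj _ _)) ?eq_lrshift ?eq_rlshift /eq_op /= ?subrr ?subr0 ?sub0r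
     ?opprK ?oppr0 //.
Qed.

Lemma ecoef_F p q s t : ecoef (F p q) s t =
  ((s == p) && (q == t))%:R - sgn2 p q * ((s == cj q) && (cj p == t))%:R.
Proof. by rewrite F_E ecoefD ecoefN ecoefZ !ecoefE. Qed.

(** Here the row [lam p] is read as the coordinates of a Cartan element. Both sides are diagonal,
    with entry 1 at [p] and -1 at [cj p], these cancelling when [cj p] is [p]. *)
Lemma F_diag p : F p p = cartan (lam p).
Proof.
apply: mx_eq_ecoef => s t; rewrite ecoef_F ecoef_cartan sgn2_diag mul1r weval_lam.
have hx u : (s == u) && (u == t) = (s == t) && (t == u).
  by apply/andP/andP => -[/eqP-> /eqP->].
by rewrite !hx; case: (s == t); rewrite /= ?mul1r // mul0r subrr.
Qed.

(** This is why [2 eps_i] is not a root, whereas [2 delta_a] is one. *)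
Lemma F_cj0 p : ~~ par p -> F p (cj p) = 0.
Proof. by move=> /negPf h; rewrite F_E cjK sgn2_cj h scale1r subrr. Qed.

Lemma root_space_F p q : root_space (lam p - lam q) (F p q).
Proof.
split=> [|h]; first exact: in_osp_F.
have := sbracketF p q (osp_cartan h); rewrite /sbracket /= expr0 !scale1r => ->.
rewrite (bigD1 p) //= [X in _ + X - _]big1 => [|s /negPf hs]; last first.
  by rewrite ecoef_cartan hs mul0r scale0r.
rewrite (bigD1 q) //= [X in _ - (_ + X)]big1 => [|s /negPf hs]; last first.
  by rewrite ecoef_cartan eq_sym hs mul0r scale0r.
by rewrite !addr0 !ecoef_cartan !eqxx !mul1r wevalBl scalerBl.
Qed.

Lemma root_space_ecoef al X p q :
  root_space al X -> ecoef X p q != 0 -> lam p - lam q = al.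
Proof.
case=> _ hX hpq; apply: weval_inj => h; apply: (mulIf hpq); rewrite -[RHS]ecoefZ -hX.
rewrite ecoefD ecoefN !ecoef_mul (bigD1 p) //= big1 => [|s /negPf hs]; last first.
  by rewrite ecoef_cartan eq_sym hs !mul0r.
rewrite (bigD1 q) //= [X in _ - (_ + X)]big1 => [|s /negPf hs]; last first.
  by rewrite ecoef_cartan hs mul0r mulr0.
by rewrite !addr0 !ecoef_cartan !eqxx !mul1r wevalBl mulrBl [ecoef X p q * _]mulrC.
Qed.

Lemma sbracketFF p q :
  sbracket (par p (+) par q) (par p (+) par q) (F p q) (F q p) =
  (1 - (q == cj p)%:R * (-1) ^+ par p) *:
    (F p p - (-1) ^+ (par p (+) par q) *: F q q).
Proof.
have := sbracketF q p (osp_F C p q); rewrite [par q (+) _]addbC andbb => ->.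
have hs : sgn2 p q * (q == cj p)%:R = (q == cj p)%:R * (-1) ^+ par p.
  by case: eqP => [->|]; rewrite ?mul1r ?mulr1 ?sgn2_cj // mul0r mulr0.
(* Only one index survives in each sum: another one could come only from the second half of [F p q],
   which needs [q = cj p] and then forces the index back to the one already extracted. *)
rewrite (bigD1 p) //= [X in _ + X - _]big1 => [|s /negPf hsp]; last first.
  rewrite ecoef_F hsp eqxx /= sub0r.
  case: eqP => [es|]; rewrite /= ?mulr0 ?oppr0 ?scale0r //.
  by case: eqP => [eq|]; rewrite /= ?mulr0 ?oppr0 ?scale0r //;
    rewrite es -eq cjK eqxx in hsp.
rewrite (bigD1 q) //= [X in _ - _ *: (_ + X)]big1 => [|s /negPf hsq]; last first.
  rewrite ecoef_F eqxx [q == s]eq_sym hsq /= sub0r.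
  case: eqP => [es|]; rewrite /= ?mulr0 ?oppr0 ?scale0r //.
  by case: eqP => [eq|]; rewrite /= ?mulr0 ?oppr0 ?scale0r //;
    rewrite -eq es cjK eqxx in hsq.
rewrite !addr0 !ecoef_F !eqxx /= -[p == _](inv_eq cjK) [cj p == q]eq_sym andbb hs.
by rewrite scalerBr !scalerA; congr (_ - _ *: _); rewrite mulrC.
Qed.

Lemma str_ecoef Y : str Y = \sum_p (-1) ^+ par p * ecoef Y p p.
Proof.
pose S : gl := block_mx 1%:M 0 0 (- 1%:M).
have Sb p : S *m ebasis p = (-1) ^+ par p *: ebasis p.
  have [u [w [-> h]]] := ebasis_split C p;
    rewrite mul_block_col !mul0mx addr0 add0r mul1mx mulNmx mul1mx.
  by case: (par p) h => ->; rewrite ?scaleN1r ?scale1r ?opp_col_mx oppr0.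
have -> : str Y = \tr (Y *m S).
  rewrite -[Y in RHS]submxK mulmx_block mxtrace_block !mulmx0 !addr0 add0r mulmx1
    mulmxN mulmx1.
  by rewrite linearN.
rewrite -[Y *m S]mulmx1 -sum_E mulmx_sumr linear_sum; apply: eq_bigr => p _.
rewrite !E_def mulmxA -(mulmxA Y) Sb -[Y *m (_ *: ebasis p)]scalemxAr -scalemxAl
  linearZ /= mxtrace_mulC.
by rewrite mulmxA /mxtrace big_ord1 ecoef_def.
Qed.

(** The two halves of [F p q] contribute equally, as [X] is in osp(m|2n), and this cancels the
    factor 1/2 of the form. Pairing with [F p q] thus reads off a matrix entry. *)
Lemma sform_F p q X : in_osp X -> sform (F p q) X = (-1) ^+ par p * ecoef X q p.
Proof.
move=> hX; rewrite /sform str_ecoef.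
have strE s t : \sum_i (-1) ^+ par i * ecoef (E s t *m X) i i = (-1) ^+ par s * ecoef X
  t s.
  have EX i j : ecoef (E s t *m X) i j = (i == s)%:R * ecoef X t j.
    rewrite ecoef_mul (bigD1 t) //= big1 => [|u /negPf hu].
      by rewrite ecoefE eqxx andbT addr0.
    by rewrite ecoefE [t == _]eq_sym hu andbF mul0r.
  rewrite (bigD1 s) //= EX eqxx mul1r big1 ?addr0 // => i /negPf hi.
  by rewrite EX hi mul0r mulr0.
under eq_bigr do rewrite F_E mulmxBl ecoefD ecoefN -scalemxAl ecoefZ mulrBr mulrCA.
rewrite sumrB strE -mulr_sumr strE osp_ecoef // par_cj sgn2_sym.
have := sgn2_sqr C q p; move: (sgn2 q p) (ecoef X q p) => x y hx.
have -> : (-1) ^+ (par q (+) par p) * x * ((-1) ^+ par q * (- x * y)) = - ((-1) ^+ par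
  p * (x * x * y)).
  by case: (par p); case: (par q) => /=; ring.
by rewrite hx mul1r opprK -mulr2n -[X in _ * X]mulr_natl mulrA mulVf ?mul1r ?pnatr_eq0.
Qed.

Lemma sform_linear a X Y (Z : gl) : sform (a *: X + Y) Z = a * sform X Z + sform Y Z.
Proof.
rewrite /sform mulmxDl -scalemxAl !str_ecoef mulrCA -mulrDr; congr (_ * _).
rewrite mulr_sumr -big_split /=; apply: eq_bigr => p _.
by rewrite ecoefD ecoefZ; ring.
Qed.

Lemma sum_idx (V : nmodType) (f : idx -> V) :
  \sum_p f p = \sum_(i < r) f (inl (inl (inl i))) + \sum_(i < r) f (inl (inl (inr i)))
   + \sum_(k < odd m) f (inl (inr k)) + (\sum_(a < n) f (inr (inl a)) + \sum_(a < n) f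
     (inr (inr a))).
Proof. by rewrite big_sumType /= big_sumType /= !big_sumType. Qed.

Definition wsign : wt := row_mx (const_mx 1) (const_mx (-1)).

Lemma wsignP k : wsign 0 k * wsign 0 k = 1.
Proof. by rewrite /wsign mxE; case: split => j; rewrite mxE ?mulr1 // mulrNN mulr1. Qed.

Lemma cartan_gramE : cartan_gram C m n = diag_mx wsign.
Proof.
apply/matrixP=> k l; rewrite mxE [RHS]mxE /sform str_ecoef.
under eq_bigr => p _.
  rewrite ecoef_mul (bigD1 p) //= big1 => [|s /negPf hs]; last first.
    by rewrite ecoef_cartan eq_sym hs !mul0r.
  rewrite !ecoef_cartan eqxx !mul1r addr0.
  over.
rewrite sum_idx /= [X in _ + X + _]big1 => [|i _]; last by rewrite !weval0l !mulr0.
under [X in _ + X + _ + _]eq_bigr do rewrite !wevalNl mulrNN.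
under [X in _ + (_ + X)]eq_bigr do rewrite !wevalNl mulrNN.
rewrite addr0 /= -!mulr2n -mulrnDl -[(_ + _) *+ 2]mulr_natl mulrA mulVf ?pnatr_eq0 //
  mul1r.
transitivity (\sum_i wsign 0 i * ((delta_mx 0 k : wt) 0 i * (delta_mx 0 l : wt) 0 i)).
  rewrite big_split_ord /=; congr (_ + _); apply: eq_bigr => i _.
    by rewrite !weval_eps /wsign row_mxEl [const_mx _ _ _]mxE.
  by rewrite !weval_delta /wsign row_mxEr [const_mx _ _ _]mxE.
rewrite (bigD1 k) //= big1 => [|i /negPf hi]; last by rewrite !mxE hi mul0r mulr0.
by rewrite addr0 ![delta_mx _ _ _ _]mxE !eqxx mul1r mulr_natr.
Qed.

Lemma wformE (l mu : wt) : wform l mu = \sum_k wsign 0 k * (l 0 k * mu 0 k).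
Proof.
rewrite /wform cartan_gramE.
have -> : invmx (diag_mx wsign) = diag_mx wsign.
  have h : diag_mx wsign *m diag_mx wsign = 1%:M.
    rewrite mulmx_diag; apply/matrixP=> i j.
    by rewrite [LHS]mxE [X in X *+ _]mxE wsignP mxE.
  by have [u1 u2] := mulmx1_unit h; rewrite -[LHS]mulmx1 -h mulKmx.
rewrite mxE; apply: eq_bigr => k _.
by rewrite mul_mx_diag [X in X * _]mxE [mu^T _ _]mxE mulrAC mulrC.
Qed.

Lemma wformC (l mu : wt) : wform l mu = wform mu l.
Proof. by rewrite !wformE; apply: eq_bigr => k _; rewrite [l _ _ * _]mulrC. Qed.

Lemma wformDl (l l' mu : wt) : wform (l + l') mu = wform l mu + wform l' mu.
Proof.
by rewrite !wformE -big_split; apply: eq_bigr => k _;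
  rewrite [(l + l') _ _]mxE mulrDl mulrDr.
Qed.

Lemma wformZl a (l mu : wt) : wform (a *: l) mu = a * wform l mu.
Proof.
by rewrite !wformE mulr_sumr; apply: eq_bigr => k _;
  rewrite [(a *: l) _ _]mxE -mulrA mulrCA.
Qed.

Lemma wformDr (l mu mu' : wt) : wform l (mu + mu') = wform l mu + wform l mu'.
Proof. by rewrite wformC wformDl !(wformC l). Qed.

Lemma wformZr a (l mu : wt) : wform l (a *: mu) = a * wform l mu.
Proof. by rewrite wformC wformZl wformC. Qed.

Lemma wform_sumr (I : Type) (s : seq I) (P : pred I) l (mu : I -> wt) :
  wform l (\sum_(i <- s | P i) mu i) = \sum_(i <- s | P i) wform l (mu i).
Proof.
apply: (big_morph (wform l)) => [x y|]; first exact: wformDr.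
by rewrite -[0](scale0r 0) wformZr mul0r.
Qed.

Lemma wform_lam (l : wt) p : wform l (lam p) = (-1) ^+ par p * weval l (lam p).
Proof.
rewrite wformE weval_sum mulr_sumr; apply: eq_bigr => k _.
rewrite mulrCA [RHS]mulrCA; congr (_ * _).
rewrite /wsign; case: (split_ordP k) => j ->;
  rewrite ?row_mxEl ?row_mxEr [const_mx _ _ _]mxE;
  case: p => [[[i|i]|i]|[i|i]];
    rewrite /= ?expr0 ?expr1 // ?mxE ?eq_lrshift ?eq_rlshift /= ?mulr0 ?oppr0 ?mulr0 //.
Qed.

(** Each coordinate of [l] is met at [p] and at [cj p], whence the factor [2]; the sign of the form
    on the [delta_a] is the parity sign. *)
Lemma wform_sqr (l : wt) :
  \sum_p (-1) ^+ par p * weval l (lam p) ^+ 2 = 2 * wform l l.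
Proof.
rewrite wformE big_split_ord sum_idx /= [X in _ + X + _]big1 => [|i _]; last first.
  by rewrite wevalC weval0l expr0n mulr0.
under [X in _ + X + _ + _]eq_bigr do rewrite wevalC wevalNl -wevalC sqrrN.
under [X in _ + (_ + X)]eq_bigr do rewrite wevalC wevalNl -wevalC sqrrN.
rewrite addr0 -!mulr2n -mulrnDl -[(_ + _) *+ 2]mulr_natl; congr (_ * (_ + _));
  apply: eq_bigr => i _.
  by rewrite wevalC weval_eps /wsign row_mxEl [const_mx _ _ _]mxE expr2.
by rewrite wevalC weval_delta /wsign row_mxEr [const_mx _ _ _]mxE expr2.
Qed.
End Cartan.

(** * The two positive systems *)

Section Positive.
Variables (C : numClosedFieldType) (m n : nat).

Local Notation r := (m./2).
Local Notation wt := 'rV[C]_(r + n).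
Local Notation idx := (idx m n).
Local Notation lam := (@lam C m n).
Local Notation F := (@F C m n).

Definition odd_pos (d : bool) : seq wt := if d then odd_posB C m n else odd_posA C m n.

(** For [d = false] every [delta_a] lies above every [eps_i], for [d = true] below. Heights decrease
    with the index, so that [eps_i - eps_j] is positive for i < j, and are at least 1, so that they
    stay above the weight 0 and the negatives. *)
Definition hgt_eps (d : bool) (i : nat) : nat := (r - i + d * n)%N.
Definition hgt_delta (d : bool) (a : nat) : nat := (n - a + ~~ d * r)%N.

(* The height orders the labels so that F p q, unless it is 0, is a positive
   root vector for the system of [odd_pos d] when hgt d q < hgt d p. *)
Definition hgt (d : bool) (p : idx) : int :=
  match p with
  | inl (inl (inl i)) => (hgt_eps d i)%:Z
  | inl (inl (inr i)) => - (hgt_eps d i)%:Z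
  | inl (inr k) => 0
  | inr (inl a) => (hgt_delta d a)%:Z
  | inr (inr a) => - (hgt_delta d a)%:Z
  end.

Definition hgt_row (d : bool) : wt :=
  row_mx (\row_i (hgt_eps d i)%:R) (\row_a (hgt_delta d a)%:R).

(** The Cartan element that detects parity: its value on a root squares to 1 if the root is odd, and
    to 0 or 4 if it is even. *)
Definition par_row : wt := row_mx 0 (const_mx 1).

Lemma weval_hgt d p : weval (lam p) (hgt_row d) = (hgt d p)%:~R.
Proof.
case: p => [[[i|i]|i]|[i|i]]; rewrite /= ?wevalNl ?weval0l ?weval_eps ?weval_delta
  /hgt_row ?row_mxEl ?row_mxEr ?mxE ?rmorphN //=.
Qed.

Lemma weval_par p : weval (lam p) par_row ^+ 2 = (par p)%:R.
Proof.
by case: p => [[[i|i]|i]|[i|i]]; rewrite /= ?wevalNl ?weval0l ?weval_eps ?weval_delta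
  /par_row ?row_mxEl ?row_mxEr ?mxE ?sqrrN ?expr1n ?expr0n.
Qed.

Lemma hgt_inj d : injective (hgt d).
Proof.
move=> p q; case: p => [[[i|i]|i]|[i|i]]; case: q => [[[j|j]|j]|[j|j]];
  rewrite /hgt /hgt_eps /hgt_delta => h; have hi := ltn_ord i; have hj := ltn_ord j;
  first [ exfalso; move: h; case: d => h; lia
        | do ! congr (_ _); apply: val_inj => /=; move: h; case: d => h; lia ].
Qed.

Lemma odd_posP d al : al \in odd_pos d ->
  0 < weval al (hgt_row d) /\ weval al par_row ^+ 2 = 1.
Proof.
have e1 i : weval (epsw C n i) (hgt_row d) = (hgt_eps d i)%:R.
  by rewrite weval_eps /hgt_row row_mxEl mxE.
have e2 i : weval (deltaw C m i) (hgt_row d) = (hgt_delta d i)%:R.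
  by rewrite weval_delta /hgt_row row_mxEr mxE.
have e3 i : weval (epsw C n i) par_row = 0.
  by rewrite weval_eps /par_row row_mxEl mxE.
have e4 i : weval (deltaw C m i) par_row = 1.
  by rewrite weval_delta /par_row row_mxEr mxE.
have hd : al \in [seq deltaw C m a | a : 'I_n] ->
    0 < weval al (hgt_row d) /\ weval al par_row ^+ 2 = 1.
  case/imageP => a _ ->; rewrite e2 e4 expr1n ltr0n; split=> //.
  by have := ltn_ord a; rewrite /hgt_delta; lia.
rewrite /odd_pos; case: d e1 e2 hd => e1 e2 hd; rewrite !mem_cat => /or3P[].
- case/imageP => -[i a] _ -> /=;
    rewrite !wevalBl e1 e2 e3 e4 sub0r sqrrN expr1n subr_gt0 ltr_nat.
  by split=> //; have := ltn_ord i; have := ltn_ord a; rewrite /hgt_eps /hgt_delta; lia.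
- case/imageP => -[i a] _ -> /=; rewrite !wevalDl e1 e2 e3 e4 add0r expr1n -natrD ltr0n.
  by split=> //; have := ltn_ord i; have := ltn_ord a; rewrite /hgt_eps /hgt_delta; lia.
- by case: ifP.
- case/imageP => -[a i] _ -> /=;
    rewrite !wevalBl e1 e2 e3 e4 subr0 expr1n subr_gt0 ltr_nat.
  by split=> //; have := ltn_ord i; have := ltn_ord a; rewrite /hgt_eps /hgt_delta; lia.
- case/imageP => -[a i] _ -> /=; rewrite !wevalDl e1 e2 e3 e4 addr0 expr1n -natrD ltr0n.
  by split=> //; have := ltn_ord i; have := ltn_ord a; rewrite /hgt_eps /hgt_delta; lia.
- by case: ifP.
Qed.

(** Height and parity are recovered from the values of the root at [hgt_row d] and [par_row],
    whichever labels represent it. *)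
Lemma odd_pos_lam d p q : lam p - lam q \in odd_pos d ->
  hgt d q < hgt d p /\ par p (+) par q.
Proof.
move=> /odd_posP; rewrite !wevalBl !weval_hgt subr_gt0 ltr_int => -[-> h]; split=> //.
have aux (x : idx) : weval (lam x) par_row = 0 \/ par x.
  have := weval_par x; case: (par x); first by right.
  by move/eqP; rewrite expf_eq0 /= => /eqP; left.
have sq (x : idx) : par x -> weval (lam x) par_row = 1 \/ weval (lam x) par_row = -1.
  move=> hx; have := weval_par x; rewrite hx => /eqP.
  by rewrite sqrf_eq1 => /orP[]/eqP; [left | right].
have n4 : (4 : C) <> 1 by apply/eqP; rewrite (eqr_nat C 4 1).
have n0 : (0 : C) <> 1 by apply/eqP; rewrite (eqr_nat C 0 1).
move: h (aux p) (aux q) (sq p) (sq q); case: (par p); case: (par q) => //= h.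
  move=> _ _ /(_ isT) h1 /(_ isT) h2; exfalso; case: h1 h => ->; case: h2 => -> h.
  - by apply: n0; rewrite -[RHS]h; ring.
  - by apply: n4; rewrite -[RHS]h; ring.
  - by apply: n4; rewrite -[RHS]h; ring.
  - by apply: n0; rewrite -[RHS]h; ring.
by case=> // h1 [] // h2; move: h; rewrite h1 h2 subrr expr0n /= => /n0.
Qed.

Lemma lam_pos d p q : hgt d q < hgt d p -> F p q != 0 ->
  lam p - lam q \in (if par p (+) par q then odd_pos d else even_pos C m n).
Proof.
move=> hpq hF.
have {hF} hc : (q == cj p) ==> par p.
  by apply: contraNT hF; rewrite negb_imply => /andP[/eqP-> h]; rewrite F_cj0.
have odm (k : 'I_(odd m)) : odd m by case: (odd m) k => // -[].
have ed1 (a c : 'I_n) : (a < c)%N -> deltaw C m a - deltaw C m c \in even_pos C m n.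
  by move=> h; rewrite mem_cat; apply/orP; left; apply/imageP; exists (a, c).
have ed2 (a c : 'I_n) : (a < c)%N -> deltaw C m a + deltaw C m c \in even_pos C m n.
  by move=> h; rewrite !mem_cat; do 1 (apply/orP; right); apply/orP; left;
    apply/imageP; exists (a, c).
have ed3 (a : 'I_n) : 2 *: deltaw C m a \in even_pos C m n.
  by rewrite !mem_cat; do 2 (apply/orP; right); apply/orP; left; apply/imageP; exists a.
have ee1 (a c : 'I_r) : (a < c)%N -> epsw C n a - epsw C n c \in even_pos C m n.
  by move=> h; rewrite !mem_cat; do 3 (apply/orP; right); apply/orP; left;
    apply/imageP; exists (a, c).
have ee2 (a c : 'I_r) : (a < c)%N -> epsw C n a + epsw C n c \in even_pos C m n.
  by move=> h; rewrite !mem_cat; do 4 (apply/orP; right); apply/orP; left;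
    apply/imageP; exists (a, c).
have ee3 (a : 'I_r) : odd m -> epsw C n a \in even_pos C m n.
  by move=> h; rewrite !mem_cat h; do 5 (apply/orP; right); apply/imageP; exists a.
have oo (a : 'I_n) : odd m -> deltaw C m a \in odd_pos d.
  by move=> h; rewrite /odd_pos; case: d {hpq}; rewrite !mem_cat h; do 2 (apply/orP;
    right); apply/imageP; exists a.
have oA1 (a : 'I_n) (i : 'I_r) : d = false -> deltaw C m a - epsw C n i \in odd_pos d.
  by move=> ->; rewrite !mem_cat; apply/orP; left; apply/imageP; exists (a, i).
have oA2 (a : 'I_n) (i : 'I_r) : d = false -> deltaw C m a + epsw C n i \in odd_pos d.
  by move=> ->; rewrite !mem_cat; apply/orP; right; apply/orP; left; apply/imageP;
    exists (a, i).
have oB1 (a : 'I_n) (i : 'I_r) : d = true -> epsw C n i - deltaw C m a \in odd_pos d.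
  by move=> ->; rewrite !mem_cat; apply/orP; left; apply/imageP; exists (i, a).
have oB2 (a : 'I_n) (i : 'I_r) : d = true -> epsw C n i + deltaw C m a \in odd_pos d.
  by move=> ->; rewrite !mem_cat; apply/orP; right; apply/orP; left; apply/imageP;
    exists (i, a).
have oB2' (a : 'I_n) (i : 'I_r) : d = true -> deltaw C m a + epsw C n i \in odd_pos d.
  by rewrite addrC; apply: oB2.
have oA2' (a : 'I_n) (i : 'I_r) : d = false -> epsw C n i + deltaw C m a \in odd_pos d.
  by rewrite addrC; apply: oA2.
move: hpq hc; case: p => [[[i|i]|i]|[i|i]]; case: q => [[[j|j]|j]|[j|j]];
  rewrite /= ?opprK ?subr0 ?sub0r ?opprK ?subrr => hpq hc.
all: have hi := ltn_ord i; have hj := ltn_ord j.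
(* Keeps failed applications below from unfolding the weights. *)
all: move: (@epsw C m n) (@deltaw C m n) (even_pos C m n) (odd_pos d)
  ed1 ed2 ed3 ee1 ee2 ee3 oo oA1 oA2 oB1 oB2 oB2' oA2'
  => eps delta ev od ed1 ed2 ed3 ee1 ee2 ee3 oo oA1 oA2 oB1 oB2 oB2' oA2'.
all: try by (exfalso; move: hpq hi hj; rewrite /hgt_eps /hgt_delta; clear; lia).
all: try by (apply: ee3 || apply: oo); apply: odm; eassumption.
all: try by (apply: ed1 || apply: ee1); move: hpq hi hj; rewrite /hgt_eps /hgt_delta;
  clear; lia.
all: try by rewrite addrC; (apply: ed1 || apply: ee1); move: hpq hi hj;
  rewrite /hgt_eps /hgt_delta; clear; lia.
all: try by rewrite add0r; (apply: ee3 || apply: oo); apply: odm; eassumption.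
all: try by (apply: oA1 || apply: oA2 || apply: oA2' || (rewrite addrC; apply: oA1));
  case: (d) hpq => // hpq; exfalso; move: hpq hi hj; rewrite /hgt_eps /hgt_delta;
    clear; lia.
all: try by (apply: oB1 || apply: oB2 || apply: oB2' || (rewrite addrC; apply: oB1));
  case: (d) hpq => // hpq; exfalso; move: hpq hi hj; rewrite /hgt_eps /hgt_delta;
    clear; lia.
all: try by case hd: (d); first [exact: oB2 | exact: oB2' | exact: oA2 | exact: oA2'].
(* Two cases are left: [eps_i + eps_j], where i = j is excluded by [hc], and [delta_i + delta_j],
   where i = j gives the long root [2 delta_i]. *)
- case: (ltngtP i j) => hij; first exact: ee2; first by rewrite addrC; apply: ee2.
  by move: hc; rewrite (val_inj hij) eqxx.
- case: (ltngtP i j) => hij; first exact: ed2; first by rewrite addrC; apply: ed2.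
  by rewrite (val_inj hij) -mulr2n -scaler_nat.
Qed.
End Positive.

(** * Weyl vectors as sums over pairs of labels *)

Section Rho.
Variables (C : numClosedFieldType) (m n : nat).

Local Notation r := (m./2).
Local Notation wt := 'rV[C]_(r + n).
Local Notation idx := (idx m n).
Local Notation lam := (@lam C m n).

Section PairSums.
Variables (V : zmodType) (k : nat).

Lemma pair_sum_lt (f : 'I_k -> 'I_k -> V) :
  \sum_(i < k) \sum_(j < k) (if (i < j)%N then f i j else 0) =
  \sum_(p : 'I_k * 'I_k | (p.1 < p.2)%N) f p.1 p.2.
Proof. by rewrite pair_big -big_mkcond. Qed.

Lemma pair_sum_gt (f : 'I_k -> 'I_k -> V) :
  \sum_(i < k) \sum_(j < k) (if (j < i)%N then f j i else 0) =
  \sum_(p : 'I_k * 'I_k | (p.1 < p.2)%N) f p.1 p.2.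
Proof. by rewrite exchange_big pair_sum_lt. Qed.

Lemma pair_sum_neq (f : 'I_k -> 'I_k -> V) : (forall i j, f i j = f j i) ->
  \sum_(i < k) \sum_(j < k) (if i == j then 0 else f i j) =
  (\sum_(p : 'I_k * 'I_k | (p.1 < p.2)%N) f p.1 p.2) *+ 2.
Proof.
move=> fC; rewrite mulr2n -{1}pair_sum_lt -pair_sum_gt -big_split.
apply: eq_bigr => i _; rewrite -big_split; apply: eq_bigr => j _ /=.
by rewrite -val_eqE; case: ltngtP => _; rewrite ?addr0 ?add0r // fC.
Qed.

Lemma pair_sum_diag (f : 'I_k -> V) :
  \sum_(i < k) \sum_(j < k) (if i == j then f i else 0) = \sum_i f i.
Proof.
apply: eq_bigr => i _; rewrite (bigD1 i) //= eqxx big1 ?addr0 // => j.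
by rewrite eq_sym => /negPf ->.
Qed.
End PairSums.

(* The factor at q = cj p is due to F p (cj p) being 0 for p even and
   2 E p (cj p) for p odd. *)
Definition kappa (p q : idx) : C :=
  (1 - (q == cj p)%:R * (-1) ^+ par p) * (-1) ^+ (par p (+) par q).

(** The systems A and B differ only in the sign of the roots [delta_a - eps_i]; the other odd roots
    are common to both. *)
Lemma sum_odd_pos d : \sum_(al <- odd_pos C m n d) al =
  (-1) ^+ d *: (\sum_(i < r) \sum_(a < n) (deltaw C m a - epsw C n i))
  + (\sum_(i < r) \sum_(a < n) (epsw C n i + deltaw C m a)
     + (\sum_(a < n) deltaw C m a) *+ odd m).
Proof.
have rm : \sum_(al <- (if odd m then [seq deltaw C m a | a : 'I_n] else [::])) al =
    (\sum_(a < n) deltaw C m a) *+ odd m.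
  by case: (odd m); rewrite ?big_nil // big_image.
case: d; rewrite /odd_pos /odd_posA /odd_posB !big_cat /= rm !big_image;
  congr (_ + (_ + _)).
- rewrite scaleN1r -sumrN; under [RHS]eq_bigr do rewrite -sumrN.
  by rewrite pair_big; apply: eq_bigr => p _; rewrite opprB.
- by rewrite pair_big.
- by rewrite scale1r exchange_big pair_big.
- by rewrite exchange_big pair_big; apply: eq_bigr => p _; rewrite addrC.
Qed.

Lemma rho_AB : rho (odd_posA C m n) = rho (odd_posB C m n)
    + \sum_(i < r) \sum_(a < n) (epsw C n i - deltaw C m a).
Proof.
have -> : \sum_(i < r) \sum_(a < n) (epsw C n i - deltaw C m a) =
    - \sum_(i < r) \sum_(a < n) (deltaw C m a - epsw C n i).
  rewrite -sumrN; apply: eq_bigr => i _; rewrite -sumrN.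
  by apply: eq_bigr => a _; rewrite opprB.
rewrite /rho -[odd_posA C m n]/(odd_pos C m n false) -[odd_posB C m n]/(odd_pos C m n
  true).
rewrite !sum_odd_pos expr0 expr1 scale1r scaleN1r.
move: (\sum_(i < r) _) (_ + _ *+ _) (\sum_(al <- _) al) => S2 S1 S0.
by apply/rowP => k; rewrite !mxE; field.
Qed.

Ltac hgt_lia i j :=
  have := ltn_ord i; have := ltn_ord j; rewrite /hgt_eps /hgt_delta; lia.

Ltac kappa_simp :=
  move=> _; rewrite /kappa /= /eq_op /= ?mul0r ?subr0 ?mul1r ?expr0 ?expr1
    ?scale1r ?scaleN1r ?opprK ?add0r ?sub0r ?opprB ?opprD ?opprK //;
  rewrite addrC.

(* Each positive root occurs twice, at (p, q) and at (cj q, cj p). *)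
Lemma sum_pos_roots d :
  \sum_p \sum_(q | hgt d q < hgt d p) kappa p q *: (lam p - lam q) =
  4 *: rho (odd_pos C m n d).
Proof.
(* Extension by 0 turns the sum into one over all pairs, which splits into 25 blocks according to
   the kinds of the two labels. *)
pose g p q := if hgt d q < hgt d p then kappa p q *: (lam p - lam q) else 0.
transitivity (\sum_p \sum_q g p q).
  by apply: eq_bigr => p _; rewrite big_mkcond.
have gE (p q : idx) (c : bool) x : (hgt d q < hgt d p) = c -> (c -> kappa p q *: (lam p
  - lam q) = x) ->
    g p q = if c then x else 0.
  by move=> h1 h2; rewrite /g h1; case: (c) h2 => // ->.
have g0 p q : hgt d p <= hgt d q -> g p q = 0.
  by rewrite /g ltNge => ->.
pose e := @epsw C m n; pose l := @deltaw C m n.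
pose ep (i : 'I_r) : idx := inl (inl (inl i)).
pose em (i : 'I_r) : idx := inl (inl (inr i)).
pose ez (i : 'I_(odd m)) : idx := inl (inr i).
pose dp (i : 'I_n) : idx := inr (inl i).
pose dm (i : 'I_n) : idx := inr (inr i).
have s2 (I K : finType) (P : I -> idx) (Q : K -> idx) (f : I -> K -> wt) :
    (forall i j, g (P i) (Q j) = f i j) ->
    \sum_i \sum_j g (P i) (Q j) = \sum_i \sum_j f i j.
  by move=> h; apply: eq_bigr => i _; apply: eq_bigr => j _.
pose Em := \sum_(p : 'I_r * 'I_r | (p.1 < p.2)%N) (e p.1 - e p.2).
pose Ep := \sum_(p : 'I_r * 'I_r | (p.1 < p.2)%N) (e p.1 + e p.2).
pose Dm := \sum_(p : 'I_n * 'I_n | (p.1 < p.2)%N) (l p.1 - l p.2).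
pose Dp := \sum_(p : 'I_n * 'I_n | (p.1 < p.2)%N) (l p.1 + l p.2).
pose S1 := \sum_(i < r) \sum_(j < n) (e i + l j).
pose S2 := \sum_(i < r) \sum_(j < n) (l j - e i).
pose Se := \sum_(i < r) e i.
pose Sl := \sum_(i < n) l i.
have eqm i j : (em j == em i) = (i == j) by apply/eqP/eqP => [[]|->].
have eqd i j : (dm j == dm i) = (i == j) by apply/eqP/eqP => [[]|->].
have sz (W : zmodType) (x : W) : \sum_(k < odd m) x = x *+ odd m.
  by rewrite sumr_const card_ord.
have v_ep_ep : \sum_i \sum_j g (ep i) (ep j) = Em.
  apply: etrans (pair_sum_lt (fun i j => e i - e j)); apply: s2 => i j;
    apply: (gE _ _ _) => /=;
    rewrite ?hd; first by hgt_lia i j.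
  by kappa_simp.
have v_em_em : \sum_i \sum_j g (em i) (em j) = Em.
  apply: etrans (pair_sum_gt (fun i j => e i - e j)); apply: s2 => i j;
    apply: (gE _ _ _) => /=;
    rewrite ?hd; first by hgt_lia i j.
  by kappa_simp.
have v_dp_dp : \sum_i \sum_j g (dp i) (dp j) = Dm.
  apply: etrans (pair_sum_lt (fun i j => l i - l j)); apply: s2 => i j;
    apply: (gE _ _ _) => /=;
    rewrite ?hd; first by hgt_lia i j.
  by kappa_simp.
have v_dm_dm : \sum_i \sum_j g (dm i) (dm j) = Dm.
  apply: etrans (pair_sum_gt (fun i j => l i - l j)); apply: s2 => i j;
    apply: (gE _ _ _) => /=;
    rewrite ?hd; first by hgt_lia i j.
  by kappa_simp.
have v_ep_em : \sum_i \sum_j g (ep i) (em j) = Ep *+ 2.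
  apply: etrans (@pair_sum_neq _ _ (fun i j => e i + e j) _) => [|i j]; last exact: addrC.
  apply: s2 => i j; apply: (gE _ _ true) => /=; first by hgt_lia i j.
  move=> _; rewrite /kappa /= opprK -/(em i) -/(em j) eqm.
  by case: eqVneq => [->|_];
    rewrite ?mul1r ?subrr ?mul0r ?subr0 ?expr0 ?mul1r ?scale0r ?scale1r.
(* On the diagonal [kappa] is 2 and the root is [2 delta_i], hence the coefficient 4. *)
have v_dp_dm : \sum_i \sum_j g (dp i) (dm j) = Dp *+ 2 + 4 *: Sl.
  have -> : 4 *: Sl = \sum_(i < n) \sum_(j < n) (if i == j then 4 *: l i else 0).
    by rewrite pair_sum_diag scaler_sumr.
  have <- := @pair_sum_neq _ _ (fun i j => l i + l j) (fun i j => addrC _ _).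
  rewrite -big_split.
  under [RHS]eq_bigr do rewrite -big_split.
  apply: s2 => i j; apply: (gE _ _ true) => /=; first by hgt_lia i j.
  move=> _; rewrite /kappa /= opprK -/(dm i) -/(dm j) eqd.
  case: eqVneq => [->|_]; last by rewrite mul0r subr0 expr0 mul1r scale1r addr0.
   rewrite add0r -mulr2n -scaler_nat scalerA; congr (_ *: _);
     rewrite expr0 expr1 mulr1n; ring.
have v_ep_ez : \sum_i \sum_j g (ep i) (ez j) = Se *+ odd m.
  rewrite -sz [RHS]exchange_big; apply: s2 => i j; apply: (gE _ _ true) => /=;
    rewrite ?hd; first by hgt_lia i j.
  by kappa_simp.
have v_ez_em : \sum_i \sum_j g (ez i) (em j) = Se *+ odd m.
  rewrite -sz; apply: s2 => i j; apply: (gE _ _ true) => /=;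
    rewrite ?hd; first by hgt_lia i j.
  by kappa_simp.
have v_dp_ez : \sum_i \sum_j g (dp i) (ez j) = - Sl *+ odd m.
  rewrite -sumrN -sz [RHS]exchange_big; apply: s2 => i j; apply: (gE _ _ true) => /=;
    rewrite ?hd; first by hgt_lia i j.
  by kappa_simp.
have v_ez_dm : \sum_i \sum_j g (ez i) (dm j) = - Sl *+ odd m.
  rewrite -sumrN -sz; apply: s2 => i j; apply: (gE _ _ true) => /=;
    rewrite ?hd; first by hgt_lia i j.
  by kappa_simp.
have v_ep_dm : \sum_i \sum_j g (ep i) (dm j) = - S1.
  rewrite /S1 -sumrN; under [RHS]eq_bigr do rewrite -sumrN; apply: s2 => i j;
    apply: (gE _ _ true) => /=;
    rewrite ?hd; first by hgt_lia i j.
  by kappa_simp.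
have v_dp_em : \sum_i \sum_j g (dp i) (em j) = - S1.
  rewrite /S1 [X in - X]exchange_big -sumrN; under [RHS]eq_bigr do rewrite -sumrN;
    apply: s2 => i j; apply: (gE _ _ true) => /=;
    rewrite ?hd; first by hgt_lia i j.
  by kappa_simp.
have v_em_ep : \sum_i \sum_j g (em i) (ep j) = 0.
  by rewrite big1 // => i _; rewrite big1 // => j _; apply: g0 => /=;
    hgt_lia i j.
have v_em_ez : \sum_i \sum_j g (em i) (ez j) = 0.
  by rewrite big1 // => i _; rewrite big1 // => j _; apply: g0 => /=;
    hgt_lia i j.
have v_em_dp : \sum_i \sum_j g (em i) (dp j) = 0.
  by rewrite big1 // => i _; rewrite big1 // => j _; apply: g0 => /=;
    hgt_lia i j.
have v_ez_ep : \sum_i \sum_j g (ez i) (ep j) = 0.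
  by rewrite big1 // => i _; rewrite big1 // => j _; apply: g0 => /=;
    hgt_lia i j.
have v_ez_ez : \sum_i \sum_j g (ez i) (ez j) = 0.
  by rewrite big1 // => i _; rewrite big1 // => j _; apply: g0 => /=;
    hgt_lia i j.
have v_ez_dp : \sum_i \sum_j g (ez i) (dp j) = 0.
  by rewrite big1 // => i _; rewrite big1 // => j _; apply: g0 => /=;
    hgt_lia i j.
have v_dm_ep : \sum_i \sum_j g (dm i) (ep j) = 0.
  by rewrite big1 // => i _; rewrite big1 // => j _; apply: g0 => /=;
    hgt_lia i j.
have v_dm_ez : \sum_i \sum_j g (dm i) (ez j) = 0.
  by rewrite big1 // => i _; rewrite big1 // => j _; apply: g0 => /=;
    hgt_lia i j.
have v_dm_dp : \sum_i \sum_j g (dm i) (dp j) = 0.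
  by rewrite big1 // => i _; rewrite big1 // => j _; apply: g0 => /=;
    hgt_lia i j.
have row (I : finType) (P : I -> idx) : \sum_i \sum_q g (P i) q =
    \sum_i \sum_j g (P i) (ep j) + \sum_i \sum_j g (P i) (em j)
    + \sum_i \sum_j g (P i) (ez j)
    + (\sum_i \sum_j g (P i) (dp j) + \sum_i \sum_j g (P i) (dm j)).
  by under eq_bigr do rewrite sum_idx; rewrite !big_split.
have -> : \sum_p \sum_q g p q =
    \sum_i \sum_q g (ep i) q + \sum_i \sum_q g (em i) q
    + \sum_i \sum_q g (ez i) q
    + (\sum_i \sum_q g (dp i) q + \sum_i \sum_q g (dm i) q).
  exact: sum_idx.
rewrite !row.
have r1 : \sum_(al <- [seq l p.1 - l p.2 | p in [pred p : 'I_n * 'I_n | (p.1 <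
  p.2)%N]]) al = Dm.
  by rewrite big_image.
have r2 : \sum_(al <- [seq l p.1 + l p.2 | p in [pred p : 'I_n * 'I_n | (p.1 <
  p.2)%N]]) al = Dp.
  by rewrite big_image.
have r3 : \sum_(al <- [seq 2 *: l a | a : 'I_n]) al = 2 *: Sl.
  by rewrite big_image scaler_sumr.
have r4 : \sum_(al <- [seq e p.1 - e p.2 | p in [pred p : 'I_r * 'I_r | (p.1 <
  p.2)%N]]) al = Em.
  by rewrite big_image.
have r5 : \sum_(al <- [seq e p.1 + e p.2 | p in [pred p : 'I_r * 'I_r | (p.1 <
  p.2)%N]]) al = Ep.
  by rewrite big_image.
have r6 : \sum_(al <- (if odd m then [seq e i | i : 'I_r] else [::])) al = Se *+ odd m.
  by case: (odd m); rewrite ?big_nil // big_image.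
have r0 : \sum_(al <- even_pos C m n) al =
    Dm + (Dp + (2 *: Sl + (Em + (Ep + Se *+ odd m)))).
  by rewrite /even_pos !big_cat /= r1 r2 r3 r4 r5 r6.
(* Only the four blocks carrying the roots [delta_a - eps_i] or their negatives depend on [d]. *)
case hd: d; last first.
{ have v_em_dm : \sum_i \sum_j g (em i) (dm j) = - S2.
  rewrite /S2 -sumrN; under [RHS]eq_bigr do rewrite -sumrN; apply: s2 => i j;
    apply: (gE _ _ true) => /=;
    rewrite ?hd; first by hgt_lia i j.
  by kappa_simp.
have v_dp_ep : \sum_i \sum_j g (dp i) (ep j) = - S2.
  rewrite /S2 [X in - X]exchange_big -sumrN; under [RHS]eq_bigr do rewrite -sumrN;
    apply: s2 => i j; apply: (gE _ _ true) => /=;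
    rewrite ?hd; first by hgt_lia i j.
  by kappa_simp.
have v_ep_dp : \sum_i \sum_j g (ep i) (dp j) = 0.
  by rewrite big1 // => i _; rewrite big1 // => j _; apply: g0; rewrite hd /=;
    hgt_lia i j.
have v_dm_em : \sum_i \sum_j g (dm i) (em j) = 0.
  by rewrite big1 // => i _; rewrite big1 // => j _; apply: g0; rewrite hd /=;
    hgt_lia i j.
  have -> : rho (odd_pos C m n false) = 2^-1 *: (Dm + (Dp + (2 *: Sl + (Em + (Ep + Se
    *+ odd m))))) - 2^-1 *: (S2 + (S1 + Sl *+ odd m)).
    by rewrite /rho r0 sum_odd_pos expr0 scale1r.
  rewrite v_em_dm v_dp_ep v_ep_dp v_dm_em v_ep_ep v_em_em v_dp_dp v_dm_dm v_ep_em
    v_dp_dm v_ep_ez v_ez_em v_dp_ez v_ez_dm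
  v_ep_dm v_dp_em v_em_ep v_em_ez v_em_dp v_ez_ep v_ez_ez v_ez_dp v_dm_ep v_dm_ez v_dm_dp.
  generalize Em Ep Dm Dp S1 S2 Se Sl; clear => Em Ep Dm Dp S1 S2 Se Sl.
  by apply/rowP => k; case: (odd m); rewrite ?mulr1n ?mulr0n !mxE; field.
}
have v_ep_dp : \sum_i \sum_j g (ep i) (dp j) = S2.
  rewrite /S2; apply: s2 => i j; apply: (gE _ _ true) => /=;
    rewrite ?hd; first by hgt_lia i j.
  by kappa_simp.
have v_dm_em : \sum_i \sum_j g (dm i) (em j) = S2.
  rewrite /S2 [RHS]exchange_big; apply: s2 => i j; apply: (gE _ _ true) => /=;
    rewrite ?hd; first by hgt_lia i j.
  by kappa_simp.
have v_em_dm : \sum_i \sum_j g (em i) (dm j) = 0.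
  by rewrite big1 // => i _; rewrite big1 // => j _; apply: g0; rewrite hd /=;
    hgt_lia i j.
have v_dp_ep : \sum_i \sum_j g (dp i) (ep j) = 0.
  by rewrite big1 // => i _; rewrite big1 // => j _; apply: g0; rewrite hd /=;
    hgt_lia i j.
  have -> : rho (odd_pos C m n true) = 2^-1 *: (Dm + (Dp + (2 *: Sl + (Em + (Ep + Se *+
    odd m))))) - 2^-1 *: (- S2 + (S1 + Sl *+ odd m)).
    by rewrite /rho r0 sum_odd_pos expr1 scaleN1r.
  rewrite v_em_dm v_dp_ep v_ep_dp v_dm_em v_ep_ep v_em_em v_dp_dp v_dm_dm v_ep_em
    v_dp_dm v_ep_ez v_ez_em v_dp_ez v_ez_dm
  v_ep_dm v_dp_em v_em_ep v_em_ez v_em_dp v_ez_ep v_ez_ez v_ez_dp v_dm_ep v_dm_ez v_dm_dp.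
  generalize Em Ep Dm Dp S1 S2 Se Sl; clear => Em Ep Dm Dp S1 S2 Se Sl.
  by apply/rowP => k; case: (odd m); rewrite ?mulr1n ?mulr0n !mxE; field.
Qed.
End Rho.

(** * The Casimir operator *)

Section Casimir.
Variables (C : numClosedFieldType) (m n : nat).

Local Notation r := (m./2).
Local Notation gl := 'M[C]_(m + (n + n)).
Local Notation wt := 'rV[C]_(r + n).
Local Notation idx := (idx m n).
Local Notation lam := (@lam C m n).
Local Notation ecoef := (@ecoef C m n).
Local Notation F := (@F C m n).
Local Notation hgt := (@hgt m n).
Local Notation kappa := (@kappa C m n).
Local Notation rhod d := (rho (odd_pos C m n d)).

Variable V : ospRep C m n.
Implicit Types (u v w : V) (X Y Z : gl) (p q : idx) (l : wt) (d : bool).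

Lemma actD X u v : in_osp X -> rep_act X (u + v) = rep_act X u + rep_act X v.
Proof. by move=> hX; have := rep_act_lin hX 1 u v; rewrite !scale1r. Qed.

Lemma act0 X : in_osp X -> rep_act X (0 : V) = 0.
Proof. by move=> hX; apply: (addIr (rep_act X (0 : V))); rewrite -actD // !add0r. Qed.

Lemma actZ X a u : in_osp X -> rep_act X (a *: u) = a *: rep_act X u.
Proof. by move=> hX; have := rep_act_lin hX a u 0; rewrite act0 // !addr0. Qed.

Lemma act_sum X (I : Type) (s : seq I) (P : pred I) (u : I -> V) : in_osp X ->
  rep_act X (\sum_(i <- s | P i) u i) = \sum_(i <- s | P i) rep_act X (u i).
Proof.
move=> hX; apply: (big_morph (fun v => rep_act X v)) => [v w|]; first exact: actD.
exact: act0.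
Qed.

Lemma act0l v : rep_act (0 : gl) v = 0.
Proof.
have h := in_osp0 C m n; have := rep_act_linl 1 v h h.
by rewrite !scale1r addr0 => /esym/eqP; rewrite -subr_eq0 addrK => /eqP.
Qed.

Lemma actDl X Y v : in_osp X -> in_osp Y ->
  rep_act (X + Y) v = rep_act X v + rep_act Y v.
Proof. by move=> hX hY; have := rep_act_linl 1 v hX hY; rewrite !scale1r. Qed.

Lemma actZl a X v : in_osp X -> rep_act (a *: X) v = a *: rep_act X v.
Proof.
move=> hX; have := rep_act_linl a v hX (in_osp0 C m n).
by rewrite act0l !addr0.
Qed.

Lemma act_suml (I : Type) (s : seq I) (P : pred I) (c : I -> C) (X : I -> gl) v :
  (forall i, in_osp (X i)) ->
  rep_act (\sum_(i <- s | P i) c i *: X i) v = \sum_(i <- s | P i) c i *: rep_act (X i) v.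
Proof.
move=> h; elim: s => [|i s IH]; first by rewrite !big_nil act0l.
rewrite !big_cons; case: (P i) => //.
by rewrite rep_act_linl ?IH //; apply: in_osp_sum.
Qed.

Lemma act_expand X v : in_osp X ->
  rep_act X v = \sum_p \sum_q (2^-1 * ecoef X p q) *: rep_act (F p q) v.
Proof.
move=> hX; rewrite {1}(osp_expand hX) pair_big /= (pair_big xpredT) /=.
by rewrite act_suml // => i; apply: in_osp_F.
Qed.

Lemma act_F z Z p q v : osp z Z ->
  rep_act Z (rep_act (F p q) v) =
  (-1) ^+ (z && (par p (+) par q)) *: rep_act (F p q) (rep_act Z v)
  + (\sum_s ecoef Z s p *: rep_act (F s q) v
     - (-1) ^+ (z && (par p (+) par q)) *: \sum_s ecoef Z q s *: rep_act (F p s) v).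
Proof.
move=> hZ; have := rep_act_bracket v hZ (osp_F C p q); rewrite sbracketF //.
have iF := @in_osp_F C m n.
move/esym/eqP; rewrite subr_eq addrC => /eqP ->; congr (_ + _).
rewrite actDl; try by [apply: in_osp_sum | rewrite -scaleNr -[_ *: _]addr0;
  apply: in_osp_lin; [apply: in_osp_sum | apply: in_osp0]].
rewrite act_suml // -scaleNr actZl ?act_suml ?scaleNr //.
by apply: in_osp_sum.
Qed.

(** Twice the Casimir element, since every root vector occurs for two pairs of labels. The signs
    come from the supertrace: by [sform_F], pairing with [F q p] gives [(-1) ^+ par q] times the
    coefficient at (p, q). *)
Definition casimir v := \sum_p \sum_q (-1) ^+ par q *: rep_act (F p q) (rep_act (F q p)
  v).

(** Moving [Z] past both factors leaves four triple sums. Two of them cancel after exchanging [p]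
    and [s], the other two after exchanging [q] and [s]. *)
Lemma casimir_comm z Z v : osp z Z -> rep_act Z (casimir v) = casimir (rep_act Z v).
Proof.
move=> hZ; have iZ := proj1 hZ; have iF := @in_osp_F C m n.
pose w a b c e := rep_act (F a b) (rep_act (F c e) v).
pose ep p q : C := (-1) ^+ (z && (par p (+) par q)).
have epq p q : ep q p = ep p q by rewrite /ep addbC.
have ep2 p q : ep p q * ep p q = 1 by rewrite /ep -expr2 sqrr_sign.
have key p q : rep_act Z (w p q q p) = rep_act (F p q) (rep_act (F q p) (rep_act Z v))
    + (\sum_s ecoef Z s p *: w s q q p - ep p q *: \sum_s ecoef Z q s *: w p s q p
       + (ep p q *: \sum_s ecoef Z s q *: w p q s p - \sum_s ecoef Z p s *: w p q q s)).
  rewrite /w (act_F p q _ hZ) (act_F q p v hZ) -/(ep p q) -/(ep q p) epq.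
  rewrite actD // actZ // actD // -scaleNr actZ // !act_sum //.
  under [\sum_i rep_act (F p q) _]eq_bigr do rewrite actZ //.
  under [X in - _ *: X]eq_bigr do rewrite actZ //.
  rewrite !scalerDr !scaleNr !scalerN !scalerA ep2 !scale1r -!addrA.
  by congr (_ + _); rewrite addrA [LHS]addrC !addrA.
rewrite /casimir act_sum // -[RHS]addr0.
under eq_bigr => p _.
  rewrite act_sum //.
  under eq_bigr => q _ do rewrite actZ // -/(w p q q p) key scalerDr.
  rewrite big_split /=.
  over.
rewrite big_split /=; congr (_ + _).
under eq_bigr => p _.
  under eq_bigr => q _ do rewrite !(scalerDr, scalerN).
  rewrite !big_split /=.
  over.
rewrite !big_split /=.
have swap (X : idx -> idx -> idx -> V) :
    \sum_p \sum_q \sum_s X p q s = \sum_p \sum_q \sum_s X s q p.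
  under eq_bigr do rewrite exchange_big.
  by rewrite exchange_big; apply: eq_bigr => p _; rewrite exchange_big.
rewrite [X in _ + X]addrC addrACA.
have -> : \sum_p \sum_q (-1) ^+ par q *: (\sum_s ecoef Z s p *: w s q q p)
   + \sum_p \sum_q - ((-1) ^+ par q *: (\sum_s ecoef Z p s *: w p q q s)) = 0.
  under [X in _ + X]eq_bigr do rewrite sumrN.
  rewrite sumrN; apply/eqP; rewrite subr_eq0; apply/eqP.
  under eq_bigr => p _ do under eq_bigr => q _ do rewrite scaler_sumr.
  rewrite swap; apply: eq_bigr => p _; apply: eq_bigr => q _.
  by rewrite scaler_sumr.
rewrite add0r.
under eq_bigr do rewrite sumrN.
rewrite sumrN addrC; apply/eqP; rewrite subr_eq0; apply/eqP.
apply: eq_bigr => p _.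
under eq_bigr do rewrite scalerA scaler_sumr.
under [RHS]eq_bigr do rewrite scalerA scaler_sumr.
rewrite exchange_big; apply: eq_bigr => q _; apply: eq_bigr => s _.
(* A nonzero entry of the homogeneous [Z] at (q, s) determines its parity, and with this value the
   signs of the two sums agree. *)
rewrite !scalerA; have [->|hqs] := eqVneq (ecoef Z q s) 0;
  first by rewrite !mulr0 !scale0r.
have hz : z = par q (+) par s by rewrite (homog_ecoef (proj2 hZ) hqs).
congr (_ * _ *: _); rewrite /ep hz.
by case: (par p); case: (par q); case: (par s) => /=; ring.
Qed.

Lemma casimir_linear : linear casimir.
Proof.
have iF := @in_osp_F C m n.
move=> a u w; rewrite /casimir scaler_sumr -big_split; apply: eq_bigr => p _.
rewrite scaler_sumr -big_split; apply: eq_bigr => q _.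
by rewrite !actD ?actZ // scalerDr !scalerA mulrC.
Qed.
HB.instance Definition _ := GRing.isLinear.Build C V V _ casimir casimir_linear.

Lemma act_osp_casimir X v : in_osp X -> rep_act X (casimir v) = casimir (rep_act X v).
Proof.
move=> hX; rewrite !act_expand // linear_sum; apply: eq_bigr => p _.
rewrite linear_sum; apply: eq_bigr => q _.
by rewrite linearZ (casimir_comm v (osp_F C p q)).
Qed.

Lemma casimir_part b v : rep_part b v -> rep_part b (casimir v).
Proof.
move=> hv; have [h0 hl] := rep_part_sub V b.
have hs (f : idx -> V) : (forall p, rep_part b (f p)) -> rep_part b (\sum_p f p).
  move=> h; elim: (index_enum _) => [|i s IH]; first by rewrite big_nil.
  by rewrite big_cons -[f i]scale1r; apply: hl.
apply: (hs) => p; apply: (hs) => q; rewrite -[_ *: _]addr0; apply: hl => //.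
have := rep_act_part (osp_F C p q) (rep_act_part (osp_F C q p) hv).
by rewrite [par q (+) _]addbC addbA addbb.
Qed.

Definition weight_vec l v := forall h, rep_act (cartan h) v = weval l h *: v.

(** Normal ordering for the order [hgt d]. The diagonal terms give [2 (l, l)]; in the terms where
    the lowering operator acts first, the two factors are exchanged, and the resulting Cartan
    brackets add up to [4 (rho, l)] by [sum_pos_roots]. *)
Lemma casimir_weight d l v : weight_vec l v ->
  casimir v = (2 * wform (l + 2 *: rhod d) l) *: v
    + 2 *: \sum_p \sum_(q | hgt d q < hgt d p)
             (-1) ^+ par p *: rep_act (F q p) (rep_act (F p q) v).
Proof.
move=> hv; have iF := @in_osp_F C m n; have iC (h : wt) := proj1 (osp_cartan h).
pose T p q := rep_act (F q p) (rep_act (F p q) v).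
(* [T q p] applies [F q p] first. The bracket of [F p q] and [F q p] lies in the Cartan subalgebra
   and acts on [v] by a scalar, which [kappa] records together with the sign. *)
have comm p q : (-1) ^+ par q *: T q p =
   wform l (kappa p q *: (lam p - lam q)) *: v + (-1) ^+ par p *: T p q.
  have hqp : osp (par p (+) par q) (F q p) by rewrite addbC; apply: osp_F.
  have := rep_act_bracket v (osp_F C p q) hqp; rewrite sbracketFF andbb.
  have iD : in_osp (F p p - (-1) ^+ (par p (+) par q) *: F q q).
    by rewrite addrC -scaleNr; apply: in_osp_lin.
  rewrite actZl // actDl //; last by rewrite -[- _]addr0 -scaleNr;
    apply: in_osp_lin => //; apply: in_osp0.
  rewrite -scaleNr actZl // !F_diag !hv -/(T q p) -/(T p q) => /esym/eqP.
  rewrite subr_eq => /eqP ->.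
  rewrite wformZr wformDr -scaleN1r wformZr !wform_lam !scalerDr !scalerA -scalerDl.
  congr (_ *: _ + _ *: _); first by rewrite /kappa; case: (par p); case: (par q) => /=;
    ring.
  by case: (par p); case: (par q) => /=; ring.
rewrite /casimir.
have -> : \sum_p \sum_q (-1) ^+ par q *: T q p =
   \sum_p (-1) ^+ par p *: T p p
   + \sum_p \sum_(q | hgt d q < hgt d p) ((-1) ^+ par q *: T q p + (-1) ^+ par p *: T p
     q).
  have -> : \sum_p \sum_(q | hgt d q < hgt d p) ((-1) ^+ par q *: T q p + (-1) ^+ par p
    *: T p q)
     = \sum_p (\sum_(q | hgt d q < hgt d p) (-1) ^+ par q *: T q p
                + \sum_(q | hgt d p < hgt d q) (-1) ^+ par q *: T q p).
    under eq_bigr do rewrite big_split /=.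
    rewrite !big_split /=; congr (_ + _).
    by rewrite (exchange_big_dep xpredT).
  rewrite -big_split; apply: eq_bigr => p _ /=.
  rewrite (bigD1 p) //=; congr (_ + _).
  rewrite (bigID (fun q => hgt d q < hgt d p)) /=; congr (_ + _); apply: eq_bigl => q.
    by case: eqVneq => // ->; rewrite ltxx.
  by rewrite -leNgt [RHS]lt_neqAle (inj_eq (@hgt_inj _ _ d)) [q == p]eq_sym.
under [X in _ + X]eq_bigr => p _.
  under eq_bigr => q _ do rewrite comm -addrA -scalerDl -mulr2n -[_ *+ 2]mulr_natl
    -scalerA.
  rewrite big_split -scaler_suml -scaler_sumr /=.
  over.
rewrite big_split -scaler_suml -scaler_sumr addrA; congr (_ + _).
have -> : \sum_p (-1) ^+ par p *: T p p = (2 * wform l l) *: v.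
  rewrite -wform_sqr scaler_suml; apply: eq_bigr => p _.
  by rewrite /T F_diag hv actZ // hv !scalerA mulrA.
rewrite -scalerDl; congr (_ *: _).
under eq_bigr do rewrite -wform_sumr.
rewrite -wform_sumr sum_pos_roots wformDl wformZl wformZr [wform (rho _) l]wformC; ring.
Qed.
End Casimir.

(** * Highest weight vectors *)

Section Singular.
Variables (C : numClosedFieldType) (m n : nat).

Local Notation r := (m./2).
Local Notation gl := 'M[C]_(m + (n + n)).
Local Notation wt := 'rV[C]_(r + n).
Local Notation idx := (idx m n).
Local Notation lam := (@lam C m n).
Local Notation F := (@F C m n).
Local Notation hgt := (@hgt m n).
Local Notation rhod d := (rho (odd_pos C m n d)).

Variable V : ospRep C m n.
Implicit Types (u v w x : V) (X Y Z : gl) (p q : idx) (l mu : wt) (d : bool).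

Definition even_highest d v :=
  forall p q, hgt d q < hgt d p -> ~~ (par p (+) par q) -> rep_act (F p q) v = 0.

Definition highest d v := forall p q, hgt d q < hgt d p -> rep_act (F p q) v = 0.

(** The even positive roots are common to both systems, so one singular vector serves for either
    order [d]. *)
Lemma singular_even l v : singular (even_pos C m n) l v -> 
  [/\ v != 0, weight_vec l v & forall d, even_highest d v].
Proof.
case=> /eqP v0 hl he; split=> // d p q hpq hpar.
have [->|hF] := eqVneq (F p q) 0; first exact: act0l.
apply: (he (lam p - lam q)); last exact: root_space_F.
by have := lam_pos hpq hF; rewrite (negPf hpar).
Qed.

Lemma singular_highest d l v :
  singular (even_pos C m n ++ odd_pos C m n d) l v ->
  [/\ v != 0, weight_vec l v & highest d v].
Proof.
case=> /eqP v0 hl he; split=> // p q hpq.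
have [->|hF] := eqVneq (F p q) 0; first exact: act0l.
apply: (he (lam p - lam q)); last exact: root_space_F.
by have := lam_pos hpq hF; rewrite mem_cat; case: ifP => _ ->; rewrite ?orbT.
Qed.

Lemma part0 b : rep_part b (0 : V).
Proof. by case: (rep_part_sub V b). Qed.

Lemma partP b a u v : rep_part b u -> rep_part b v -> rep_part b (a *: u + v).
Proof. by case: (rep_part_sub V b) => _; apply. Qed.

Lemma partZ b a u : rep_part b u -> rep_part b (a *: u).
Proof. by move=> h; rewrite -[_ *: _]addr0; apply: partP => //; apply: part0. Qed.

Lemma part_eq0 b u v : rep_part b u -> rep_part (~~ b) v -> u + v = 0 ->
  u = 0 /\ v = 0.
Proof.
move=> hu hv /eqP; rewrite addr_eq0 => /eqP e.
have hu' : rep_part (~~ b) u by rewrite e -scaleN1r; apply: partZ.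
have u0 : u = 0.
  by case: b hu hv hu' => hu hv hu'; apply: rep_part_cap => //.
by split=> //; apply/eqP; rewrite -oppr_eq0 -e u0.
Qed.

Lemma part_eq b u u' v v' : rep_part b u -> rep_part b u' ->
  rep_part (~~ b) v -> rep_part (~~ b) v' -> u + v = u' + v' -> u = u' /\ v = v'.
Proof.
move=> hu hu' hv hv' /eqP; rewrite -subr_eq0 opprD addrACA => /eqP e.
have aux c (y z : V) : rep_part c y -> rep_part c z -> rep_part c (y - z).
  by move=> hy hz; rewrite addrC -scaleN1r; apply: partP.
have [] := part_eq0 (aux _ _ _ hu hu') (aux _ _ _ hv hv') e.
by move=> /eqP; rewrite subr_eq0 => /eqP -> /eqP; rewrite subr_eq0 => /eqP ->.
Qed.

(** Cartan elements and all [F p q] are homogeneous, so each parity component of [v] satisfies the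
    same equations and at least one is nonzero. A homogeneous vector is wanted because the submodule
    that it generates is graded. *)
Lemma homog_highest d l v : v != 0 -> weight_vec l v -> highest d v ->
  exists b w, [/\ rep_part b w, w != 0, weight_vec l w & highest d w].
Proof.
move=> v0 hl hh; have [w0 [w1 [h0 h1 e]]] := rep_part_add v.
have hw : [/\ weight_vec l w0, highest d w0, weight_vec l w1 & highest d w1].
  have hc h : rep_act (cartan h) w0 = weval l h *: w0 /\ rep_act (cartan h) w1 = weval
    l h *: w1.
    have oc := osp_cartan h; apply: (@part_eq false).
    - exact: (rep_act_part oc h0).
    - exact: partZ.
    - exact: (rep_act_part oc h1).
    - exact: partZ.
    rewrite -actD -?e ?hl ?e ?scalerDr //; exact: proj1 oc.
  have hF p q : hgt d q < hgt d p -> rep_act (F p q) w0 = 0 /\ rep_act (F p q) w1 = 0.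
    move=> hpq; have oF := osp_F C p q; apply: (@part_eq0 (par p (+) par q)).
    - by have := rep_act_part oF h0; rewrite addbF.
    - by have := rep_act_part oF h1; rewrite addbT.
    rewrite -actD -?e ?hh //; exact: proj1 oF.
  split; try by move=> h; case: (hc h).
    by move=> p q /hF[].
  by move=> p q /hF[].
case: hw => a1 a2 a3 a4.
have [w00|n0] := eqVneq w0 0; last by exists false, w0.
by exists true, w1; split=> //; apply: contraNneq v0 => w10; rewrite e w00 w10 addr0.
Qed.

(** The eigenspace of [casimir] for the scalar found on [v] is a submodule, as [casimir] commutes
    with the action, and it is graded, as [casimir] is even. It contains [v], so by simplicity it is
    everything. *)
Lemma casimir_simple d l v : simple_rep V -> v != 0 -> weight_vec l v -> highest d v ->
  forall u, casimir u = (2 * wform (l + 2 *: rhod d) l) *: u.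
Proof.
move=> [_ hs] v0 hl hh; set c := 2 * _.
have cv : casimir v = c *: v.
  rewrite (casimir_weight d hl) big1 ?scaler0 ?addr0 // => p _; rewrite big1 // => q hq.
  by rewrite hh // act0 ?scaler0 //; apply: in_osp_F.
case: (hs (fun u => casimir u = c *: u)) => //.
- split.
    split=> [|a u w hu hw]; first by rewrite linear0 scaler0.
    by rewrite casimir_linear hu hw scalerDr !scalerA mulrC.
  by move=> X u hX hu; rewrite -act_osp_casimir // hu actZ.
- move=> u hu; have [w0 [w1 [h0 h1 e]]] := rep_part_add u; exists w0, w1.
  have [e0 e1] : casimir w0 = c *: w0 /\ casimir w1 = c *: w1.
    apply: (@part_eq false); try exact: partZ; try exact: casimir_part.
    by rewrite -[RHS]scalerDr -e -hu e linearD.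
  by split.
by move=> h; move: v0; rewrite (h v cv) eqxx.
Qed.

Section Descend.
Variables (d b : bool) (mu : wt) (v : V).
Hypotheses (hv : rep_part b v) (hw : weight_vec mu v) (hh : highest d v).

(* The span of the vectors obtained from v by lowering operators; it is the
   submodule generated by v. *)
Inductive low : V -> Prop :=
| low_gen : low v
| low_lin a x y of low x & low y : low (a *: x + y)
| low_act p q x of hgt d p < hgt d q & low x : low (rep_act (F p q) x).

Lemma low0 : low 0.
Proof. by rewrite -(addNr v) -scaleN1r; apply: low_lin; apply: low_gen. Qed.

Lemma lowZ a x : low x -> low (a *: x).
Proof. by move=> h; rewrite -[_ *: _]addr0; apply: low_lin => //; apply: low0. Qed.

Lemma lowD x y : low x -> low y -> low (x + y).
Proof. by move=> hx hy; rewrite -[x]scale1r; apply: low_lin. Qed.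

Lemma low_sum (I : Type) (s : seq I) (P : pred I) (x : I -> V) :
  (forall i, low (x i)) -> low (\sum_(i <- s | P i) x i).
Proof. by move=> h; elim/big_ind: _ => //; [apply: low0 | apply: lowD]. Qed.

(** Commuting [F p q] past the outermost lowering operator leaves, besides the reordered product,
    only single operators [F] applied to the shorter vector, so the induction closes. *)
Lemma low_F p q x : low x -> low (rep_act (F p q) x).
Proof.
have iF := @in_osp_F C m n.
move=> hx; elim: hx p q => [p q|a y z _ IHy _ IHz p q|s t y hst hy IH p q].
- have [hpq|hqp|e] := ltgtP (hgt d p) (hgt d q).
  + by apply: low_act => //; apply: low_gen.
  + by rewrite hh //; apply: low0.
  + by rewrite (hgt_inj e) F_diag hw; apply: lowZ; apply: low_gen.
- by rewrite actD // actZ //; apply: low_lin.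
rewrite (act_F s t y (osp_F C p q)); apply: lowD; last apply: lowD.
- by apply: lowZ; apply: low_act.
- by apply: low_sum => i; apply: lowZ.
- by rewrite -scaleNr; apply: lowZ; apply: low_sum => i; apply: lowZ.
Qed.

Lemma low_osp X x : in_osp X -> low x -> low (rep_act X x).
Proof.
move=> hX hx; rewrite act_expand //; apply: low_sum => p; apply: low_sum => q.
by apply: lowZ; apply: low_F.
Qed.

Lemma low_graded : graded low.
Proof.
have iF := @in_osp_F C m n.
have part_id (c : bool) y z : low y /\ rep_part c y -> low z /\ rep_part (~~ c) z ->
    exists v0 v1, [/\ low v0 /\ rep_part false v0, low v1 /\ rep_part true v1 & y + z =
      v0 + v1].
  by case: c => hy hz; [exists z, y; rewrite addrC | exists y, z].
move=> x; elim=> {x} [|a x y _ [x0 [x1 [[l0 p0] [l1 p1] ->]]] _ [y0 [y1 [[k0 q0] [k1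
  q1] ->]]]|p q x hpq _ [x0 [x1 [[l0 p0] [l1 p1] ->]]]].
- rewrite -[v]addr0; apply: (part_id b).
    by split=> //; exact: low_gen.
  by split; [apply: low0 | apply: part0].
- exists (a *: x0 + y0), (a *: x1 + y1); split; first by split;
    [apply: low_lin | apply: partP].
    by split; [apply: low_lin | apply: partP].
  by rewrite scalerDr addrACA.
- rewrite actD //; apply: (part_id (par p (+) par q)).
    by split; [apply: low_act | have := rep_act_part (osp_F C p q) p0; rewrite addbF].
  by split; [apply: low_act | have := rep_act_part (osp_F C p q) p1; rewrite addbT].
Qed.

Let h0 := hgt_row C m n d.
Let c0 := weval mu h0.
(** The factor that kills the vectors lying [k] below [v] for the Cartan element [h0]; [ops] is a
    product of such factors. *)
Let op (k : C) x := rep_act (cartan h0) x - (c0 - k) *: x.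
Let ops (s : seq C) x := foldr op x s.

Let op_lin k a x y : op k (a *: x + y) = a *: op k x + op k y.
Proof.
have iH := proj1 (osp_cartan h0).
rewrite /op actD // actZ // scalerDr opprD scalerBr !scalerA [a * _]mulrC.
by rewrite addrACA.
Qed.

Let ops_lin s a x y : ops s (a *: x + y) = a *: ops s x + ops s y.
Proof. by elim: s => //= k s IH; rewrite IH op_lin. Qed.

Let ops0 s : ops s 0 = 0.
Proof.
have := ops_lin s 1 0 0; rewrite !scale1r addr0 => /eqP.
by rewrite -subr_eq0 opprD addNKr oppr_eq0 => /eqP.
Qed.

Let opC k j x : op k (op j x) = op j (op k x).
Proof.
have iH := proj1 (osp_cartan h0).
rewrite /op -!scaleNr !actD // !actZ // !scalerDr !scalerA -!addrA; congr (_ + _).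
by rewrite addrCA [_ * (- (c0 - j))]mulrC.
Qed.

Let ops_op s k x : ops s (op k x) = op k (ops s x).
Proof. by elim: s => //= j s ->; rewrite opC. Qed.

Let opsC s t x : ops s (ops t x) = ops t (ops s x).
Proof. by elim: t => //= k t IH; rewrite ops_op IH. Qed.

Let ops_cat s t x : ops (s ++ t) x = ops s (ops t x).
Proof. exact: foldr_cat. Qed.

Let dl p q : C := (hgt d q)%:~R - (hgt d p)%:~R.

Let op_F k p q x : op (k + dl p q) (rep_act (F p q) x) = rep_act (F p q) (op k x).
Proof.
have iH := proj1 (osp_cartan h0); have iF := @in_osp_F C m n.
rewrite /op (act_F p q x (osp_cartan h0)) expr0 !scale1r.
rewrite (bigD1 p) //= [X in _ + (_ + X - _)]big1 => [|s /negPf hs]; last first.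
  by rewrite ecoef_cartan hs mul0r scale0r.
rewrite (bigD1 q) //= [X in _ + (_ - (_ + X))]big1 => [|s /negPf hs]; last first.
  by rewrite ecoef_cartan eq_sym hs mul0r scale0r.
rewrite !addr0 !ecoef_cartan !eqxx !mul1r !weval_hgt.
rewrite -[in RHS]scaleNr actD // actZ // -addrA; congr (_ + _).
by rewrite -!scaleNr -!scalerDl /dl; congr (_ *: _); ring.
Qed.

Let ops_F s p q x :
  ops [seq k + dl p q | k <- s] (rep_act (F p q) x) = rep_act (F p q) (ops s x).
Proof. by elim: s => //= k s ->; rewrite op_F. Qed.

(* Separates weights without decomposing x: a product of operators h - c with
   c < mu(h) sends x and a multiple of v to the same vector. *)
Lemma low_ops x : low x -> exists a s, all (fun k => 0 < k) s /\ ops s (x - a *: v) = 0.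
Proof.
have iF := @in_osp_F C m n.
elim=> {x} [|t x y _ [a [s [ps es]]] _ [a' [s' [ps' es']]]|p q x hpq _ [a [s [ps es]]]].
- by exists 1, [::]; rewrite scale1r /= subrr.
- exists (t * a + a'), (s ++ s'); rewrite all_cat ps ps'; split=> //.
  have -> : t *: x + y - (t * a + a') *: v = t *: (x - a *: v) + (y - a' *: v).
    by rewrite scalerDl scalerBr scalerA opprD addrACA.
  by rewrite ops_lin !ops_cat es' ops0 addr0 opsC es ops0 scaler0.
have hd : 0 < dl p q by rewrite subr_gt0 ltr_int.
(* Write [x] as [x - a *: v] plus [a *: v]. After [F p q], the first part is killed by the factors
   shifted by the drop [dl p q], and the second, lying exactly [dl p q] below [v], by the added
   factor; so the multiple of [v] is 0. *)
exists 0, (dl p q :: [seq k + dl p q | k <- s]); split.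
  by rewrite /= hd all_map; apply: sub_all ps => k /= hk; apply: addr_gt0.
have -> : rep_act (F p q) x - 0 *: v = rep_act (F p q) (x - a *: v) + a *: rep_act (F p
  q) v.
  by rewrite scale0r subr0 -scaleNr actD // actZ // scaleNr subrK.
rewrite addrC ops_lin /= (ops_F s p q (x - a *: v)) es act0 // .
have e : op (dl p q) (rep_act (F p q) v) = 0.
  rewrite -[dl p q]add0r op_F /op hw subr0 subrr act0 //.
rewrite -ops_op e ops0 scaler0 add0r /op act0 ?scaler0 ?subrr //.
by case: (osp_cartan h0).
Qed.

Lemma ops_eigen s u l : weight_vec l u ->
  ops s u = (\prod_(k <- s) (weval l h0 - c0 + k)) *: u.
Proof.
move=> hu; have iH := proj1 (osp_cartan h0).
elim: s => [|k s IH]; first by rewrite big_nil scale1r.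
rewrite /= IH /op actZ // hu big_cons !scalerA -scalerBl; congr (_ *: _); ring.
Qed.

(** By simplicity [u] lies in [low], so some product of factors sends [u] to a multiple of [v]. On
    [u] this product is a scalar: if it vanishes, one factor places [l] strictly below [mu];
    otherwise [u] is a multiple of [v] and the weights agree. *)
Lemma weight_descends u l : simple_rep V -> v != 0 -> u != 0 -> weight_vec l u ->
  l = mu \/ exists2 k, 0 < k & weval l (hgt_row C m n d) = weval mu (hgt_row C m n d) - k.
Proof.
case=> _ hs v0 u0 hu.
case: (hs low).
- split; first by split; [apply: low0 | move=> *; apply: low_lin].
  by move=> X x; apply: low_osp.
- exact: low_graded.
- by move=> h; move: v0; rewrite (h v low_gen) eqxx.
move=> /(_ u) /low_ops[a [s [ps]]].
have -> : u - a *: v = - a *: v + u by rewrite addrC scaleNr.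
rewrite ops_lin (ops_eigen s hu) (ops_eigen s hw) => e.
have [/eqP | hP] := eqVneq (\prod_(k <- s) (weval l h0 - c0 + k)) 0.
  rewrite prodf_seq_eq0 => /hasP[k ks /= /eqP ek]; right; exists k;
    first exact: (allP ps).
  by apply/eqP; rewrite -subr_eq0 opprB addrA; apply/eqP; rewrite -[RHS]ek /c0 /h0; ring.
left; pose t := a * (\prod_(k <- s) (weval mu h0 - c0 + k)) / \prod_(k <- s) (weval l
  h0 - c0 + k).
have eu : u = t *: v.
  apply: (scalerI hP); rewrite scalerA /t mulrC divfK //.
  by apply/eqP; rewrite -subr_eq0 -scalerA addrC -scaleNr; apply/eqP.
apply: weval_inj => h; apply/eqP; rewrite -subr_eq0.
have : (weval l h - weval mu h) *: u = 0.
  rewrite scalerBl -hu {1}eu actZ ?hw; last by case: (osp_cartan h).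
  by rewrite eu !scalerA mulrC subrr.
by move/eqP; rewrite scaler_eq0 (negPf u0) orbF.
Qed.
End Descend.

(** If the weights differed, each would lie strictly below the other at [hgt_row d]. *)
Lemma highest_weight_unique d l mu u v : simple_rep V ->
  u != 0 -> weight_vec l u -> highest d u ->
  v != 0 -> weight_vec mu v -> highest d v -> l = mu.
Proof.
move=> hs u0 hu1 hu2 v0 hv1 hv2.
have [b [x [xb x0 x1 x2]]] := homog_highest u0 hu1 hu2.
have [b' [y [yb y0 y1 y2]]] := homog_highest v0 hv1 hv2.
have [//|[k k0 ek]] := weight_descends yb y1 y2 hs y0 x0 x1.
have [//|[k' k0' ek']] := weight_descends xb x1 x2 hs x0 y0 y1.
have : k + k' = 0 by rewrite -[k](subKr (weval mu (hgt_row C m n d))) -ek ek'; ring.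
by move/eqP; rewrite gt_eqF // addr_gt0.
Qed.
End Singular.

(** * The Dirac inequality *)

Section Dirac.
Variables (C : numClosedFieldType) (m n : nat).

Local Notation r := (m./2).
Local Notation gl := 'M[C]_(m + (n + n)).
Local Notation wt := 'rV[C]_(r + n).
Local Notation lam := (@lam C m n).
Local Notation ecoef := (@ecoef C m n).
Local Notation F := (@F C m n).
Local Notation hgt := (@hgt m n).
Local Notation rhod d := (rho (odd_pos C m n d)).

Lemma sum_root_spaces_ecoef (D : seq wt) X : sum_root_spaces D X ->
  in_osp X /\ forall p q, ecoef X p q != 0 -> lam p - lam q \in D.
Proof.
case=> Y hY ->; split.
  rewrite big_seq; elim/big_ind: _ => [|x y hx hy|al /hY[]//]; first exact: in_osp0.
  by rewrite -[x]scale1r; apply: in_osp_lin.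
move=> p q; apply: contraNT => hpq; rewrite ecoef_sum big_seq big1 // => al hal.
by apply: contraNeq hpq => /(root_space_ecoef (hY _ hal)) ->.
Qed.

(** [D] is a sequence, so a root is summed as often as it is listed; the component at this root is
    divided by its multiplicity [c]. *)
Lemma F_sum_root_spaces (D : seq wt) p q : lam p - lam q \in D ->
  sum_root_spaces D (F p q).
Proof.
move=> hD; set al := lam p - lam q in hD *.
pose c : C := (count_mem al D)%:R.
have c0 : c != 0 by rewrite pnatr_eq0 -lt0n -has_count has_pred1.
exists (fun be => if be == al then c^-1 *: F p q else 0) => [be _|].
  have [hF hr] := root_space_F C p q.
  case: eqP => [->|_]; split=> [|h].
  - by rewrite -[_ *: _]addr0; apply: in_osp_lin => //; apply: in_osp0.
  - by rewrite -scalemxAr -scalemxAl -scalerBr hr !scalerA mulrC.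
  - exact: in_osp0.
  - by rewrite mulmx0 mul0mx subrr scaler0.
rewrite -big_mkcond /= big_const_seq iter_addr_0 -scaler_nat scalerA mulfV ?scale1r //.
Qed.

Section Adapted.
Variables (d : bool) (N : nat) (e x : N.-tuple gl).
Hypothesis he : is_basis (sum_root_spaces (odd_pos C m n d)) e.
Hypothesis hx : is_basis (sum_root_spaces [seq - al | al <- odd_pos C m n d]) x.
Hypothesis hex : forall i j, sform (tnth e i) (tnth x j) = (i == j)%:R.

Lemma adapted_in_osp i : in_osp (tnth e i) /\ in_osp (tnth x i).
Proof.
have h1 : sum_root_spaces (odd_pos C m n d) (tnth e i).
  by apply/(proj2 he)/memv_span/mem_tnth.
have h2 : sum_root_spaces [seq - al | al <- odd_pos C m n d] (tnth x i).
  by apply/(proj2 hx)/memv_span/mem_tnth.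
by split; [case: (sum_root_spaces_ecoef h1) | case: (sum_root_spaces_ecoef h2)].
Qed.

Lemma adapted_ecoef i p q : ecoef (tnth x i) p q != 0 ->
  hgt d p < hgt d q /\ par p (+) par q.
Proof.
have h2 : sum_root_spaces [seq - al | al <- odd_pos C m n d] (tnth x i).
  by apply/(proj2 hx)/memv_span/mem_tnth.
move/(proj2 (sum_root_spaces_ecoef h2)) => /mapP[al hal ea].
by rewrite addbC; apply: (@odd_pos_lam C); rewrite -opprB ea opprK.
Qed.

(** The coordinates of [F p q] in the basis [e] are its pairings with the dual basis [x], and
    [sform_F] evaluates these as matrix entries. *)
Lemma adapted_F p q : hgt d q < hgt d p -> par p (+) par q ->
  F p q = \sum_i ((-1) ^+ par p * ecoef (tnth x i) q p) *: tnth e i.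
Proof.
move=> hpq hpar.
have hF : F p q \in <<e>>%VS.
  have [->|hF] := eqVneq (F p q) 0; first exact: mem0v.
  apply/(proj2 he)/F_sum_root_spaces.
  by have := lam_pos hpq hF; rewrite hpar.
rewrite {1}(coord_span hF); apply: eq_bigr => i _.
rewrite -(tnth_nth 0); congr (_ *: _).
rewrite -(sform_F p q (proj2 (adapted_in_osp i))) [in RHS](coord_span hF).
have slin : forall (s : seq 'I_N) (c : 'I_N -> C),
    sform (\sum_(j <- s) c j *: e`_j) (tnth x i) = \sum_(j <- s) c j * (j == i)%:R.
  move=> s c; elim: s => [|j s IH].
    rewrite !big_nil; have := sform_linear 1 0 0 (tnth x i).
    by rewrite !scale1r addr0 mul1r => /eqP;
      rewrite -subr_eq0 opprD addNKr oppr_eq0 => /eqP.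
  by rewrite !big_cons sform_linear IH -(tnth_nth 0) hex.
rewrite slin (bigD1 i) //= eqxx mulr1 big1 ?addr0 // => j /negPf ->.
by rewrite mulr0.
Qed.

Variable V : ospRep C m n.

(** The matrix entries of the [x_i] that express [F p q] through the [e_i] also express [2 *: x_i]
    through the [F q p]; substituting one expansion into the other gives the dual basis form. Even
    pairs vanish on [v], and the factor 2 is again the double counting. *)
Lemma adapted_laplace (v : V) : (forall d, even_highest d v) ->
  \sum_p \sum_(q | hgt d q < hgt d p) (-1) ^+ par p *: rep_act (F q p) (rep_act (F p q) v)
  = 2 *: \sum_i rep_act (tnth x i) (rep_act (tnth e i) v).
Proof.
move=> hv; have iF := @in_osp_F C m n.
have ie i := proj1 (adapted_in_osp i); have ix i := proj2 (adapted_in_osp i).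
have xE i (w : V) : 2 *: rep_act (tnth x i) w =
    \sum_p \sum_(q | hgt d q < hgt d p) ecoef (tnth x i) q p *: rep_act (F q p) w.
  rewrite act_expand // scaler_sumr.
  under eq_bigr do rewrite scaler_sumr.
  rewrite exchange_big /=; apply: eq_bigr => p _.
  rewrite [RHS]big_mkcond /=; apply: eq_bigr => q _.
  rewrite scalerA mulrA mulfV ?mul1r ?pnatr_eq0 //.
  case: ifPn => // hpq; have [->|/adapted_ecoef[h _]] := eqVneq (ecoef (tnth x i) q p) 0.
    by rewrite scale0r.
  by rewrite h in hpq.
rewrite scaler_sumr; under [RHS]eq_bigr do rewrite xE.
rewrite [RHS]exchange_big /=; apply: eq_bigr => p _.
rewrite [RHS]exchange_big /=; apply: eq_bigr => q hpq.
have [hpar|hpar] := boolP (par p (+) par q); last first.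
  rewrite (hv d) // act0 // scaler0 big1 // => i _.
  have [->|/adapted_ecoef[_ h]] := eqVneq (ecoef (tnth x i) q p) 0;
    first by rewrite scale0r.
  by rewrite addbC h in hpar.
rewrite (adapted_F hpq hpar) act_suml // act_sum // scaler_sumr; apply: eq_bigr => i _.
by rewrite actZ // scalerA mulrA -signr_addb addbb mul1r.
Qed.
End Adapted.

Lemma dirac_inequality (V : ospRep C m n) (om : gl -> gl) (d d' s : bool)
    (L L' mu : wt) (u u' v : V) :
  simple_rep V -> unitary om V -> adapted om (odd_pos C m n d) s ->
  u != 0 -> weight_vec L u -> highest d u ->
  u' != 0 -> weight_vec L' u' -> highest d' u' ->
  v != 0 -> weight_vec mu v -> (forall d, even_highest d v) ->
  let Q := - (-1) ^+ s * (- wform (L' + 2 *: rhod d') L' + wform (mu + 2 *: rhod d) mu) in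
  0 <= Q /\ (mu <> L -> 0 < Q).
Proof.
move=> hs [f [_ hf]] [N [e [x [he hx hex hom]]]] u0 hu1 hu2 u0' hu1' hu2' v0 hv1 hv2 Q.
have ie i := proj1 (adapted_in_osp he hx i); have ix i := proj2 (adapted_in_osp he hx i).
pose a := wform (L' + 2 *: rhod d') L'; pose c := wform (mu + 2 *: rhod d) mu.
pose S := \sum_i f (rep_act (tnth e i) v) (rep_act (tnth e i) v).
have S_ge0 i : 0 <= f (rep_act (tnth e i) v) (rep_act (tnth e i) v).
  have [->|h] := eqVneq (rep_act (tnth e i) v) 0; first by rewrite linear0l.
  by apply/ltW/neq0_dnorm_gt0.
have fv : 0 < f v v by apply: neq0_dnorm_gt0.
(* One scalar of [casimir] is computed twice, from the highest weight vector [u'] for [d'] and by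
   normal ordering on [v] for [d]; both are paired with [v]. *)
have eqn : (a - c) * f v v = 2 * ((-1) ^+ s * S).
  have := casimir_simple hs u0' hu1' hu2' v.
  rewrite (casimir_weight d hv1) (adapted_laplace he hx hex hv2) scalerA -/a -/c.
  move=> /(congr1 (fun w => f w v)); rewrite linearDl !linearZl_LR /= linear_sumlz.
  have -> : \sum_i f (rep_act (tnth x i) (rep_act (tnth e i) v)) v = (-1) ^+ s * S.
    rewrite mulr_sumr; apply: eq_bigr => i _.
    (* The form is conjugate-linear in its second argument, but the sign [(-1) ^+ s] is real and
       comes out unchanged. *)
    rewrite hf // hom actZl // linearZr_LR /=; congr (_ * _).
    by rewrite rmorphXn /= rmorphN1.
  move=> h; have n2 : (2 : C) != 0 by rewrite pnatr_eq0.
  apply: (mulfI n2); rewrite mulrBl mulrBr !mulrA -h; ring.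
have QS : Q * f v v = 2 * S.
  rewrite /Q -/a -/c; have -> : - (-1) ^+ s * (- a + c) * f v v = (-1) ^+ s * ((a - c)
    * f v v) by ring.
  by rewrite eqn mulrCA signrMK.
have S0 : 0 <= S by apply: sumr_ge0.
have Q0 : 0 <= Q by rewrite -(pmulr_lge0 _ fv) QS mulr_ge0.
split=> // hmu; rewrite lt_def Q0 andbT; apply: contra_notN hmu => /eqP Qz.
have /eqP : S = 0.
  by apply/eqP; move/eqP: QS; rewrite Qz mul0r eq_sym mulf_eq0 pnatr_eq0.
rewrite psumr_eq0 // => /allP hS.
have ev i : rep_act (tnth e i) v = 0.
  apply: contraTeq (hS i (mem_index_enum i)) => h /=.
  by rewrite gt_eqF // neq0_dnorm_gt0.
apply: (highest_weight_unique (d := d) hs v0 hv1 _ u0 hu1 hu2) => p q hpq.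
have [hpar|hpar] := boolP (par p (+) par q); last exact: hv2 hpq hpar.
rewrite (adapted_F he hx hex hpq hpar) act_suml // big1 // => i _.
by rewrite ev scaler0.
Qed.
End Dirac.

(** * Transport to a single module and conclusion *)

Lemma rep_iso_inv (C : numClosedFieldType) (m n : nat) (V W : ospRep C m n) :
  rep_iso V W -> exists phi : W -> V,
  [/\ forall w, w != 0 -> phi w != 0,
      forall a w, phi (a *: w) = a *: phi w
    & forall X w, in_osp X -> rep_act X (phi w) = phi (rep_act X w)].
Proof.
case=> f [[g fK gK] _ fX]; exists g; split=> [w|a w|X w hX].
- by apply: contraNneq => gw0; rewrite -[w]gK gw0 linear0.
- by apply: (can_inj fK); rewrite linearZ /= !gK.
- by apply: (can_inj fK); rewrite fX // !gK.
Qed.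

Lemma even_constituent_inequality (C : numClosedFieldType) (m n : nat)
  (om : 'M[C]_(m + (n + n)) -> 'M[C]_(m + (n + n)))
  (LA LB : ospRep C m n) (e : bool) (Lam Lam' : 'rV[C]_(m./2 + n))
  (hLA : simple_highest_weight LA Lam (odd_posA C m n))
  (hLB : simple_highest_weight LB Lam' (odd_posB C m n))
  (hiso : rep_iso LA (if e then parity_rev LB else LB))
  (hunit : unitary om LA) :
  (forall s : bool, adapted (om) (odd_posA C m n) s ->
     forall mu : 'rV[C]_(m./2 + n), even_constituent LB mu ->
       let rhoB := rho (odd_posB C m n) in
       let Q := - (-1) ^+ s *
         (- wform (Lam' + 2 *: rhoB) Lam' + wform (mu + 2 *: rhoB) mu
          + 2 * \sum_(i < m./2) \sum_(a < n)
                  wform mu (epsw C n i - deltaw C m a)) in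
       0 <= Q /\ (mu <> Lam -> 0 < Q))
  /\
  (forall s : bool, adapted (om) (odd_posB C m n) s ->
     forall mu : 'rV[C]_(m./2 + n), even_constituent LA mu ->
       let rhoA := rho (odd_posA C m n) in
       let Q := - (-1) ^+ s *
         (- wform (Lam + 2 *: rhoA) Lam + wform (mu + 2 *: rhoA) mu
          - 2 * \sum_(i < m./2) \sum_(a < n)
                  wform mu (epsw C n i - deltaw C m a)) in
       0 <= Q /\ (mu <> Lam' -> 0 < Q)).
Proof.
(* Parity reversal keeps the space and the action, so in both cases the inverse isomorphism is a map
   out of [LB]. It brings the highest weight vector for B, and any even singular vector of [LB],
   into [LA], where the form is given. *)
have [phi [phi_neq0 phiZ phiX]] : exists phi : LB -> LA,
    [/\ forall w, w != 0 -> phi w != 0,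
        forall a w, phi (a *: w) = a *: phi w
      & forall X w, in_osp X -> rep_act X (phi w) = phi (rep_act X w)].
  by case: e hiso => /rep_iso_inv.
have phi0 : phi 0 = 0 by rewrite -[0 in LHS](scale0r 0) phiZ scale0r.
have phiw l v : weight_vec l v -> weight_vec l (phi v).
  by move=> h k; rewrite phiX ?h ?phiZ //; case: (osp_cartan k).
have phiz p q v : rep_act (F C p q) v = 0 -> rep_act (F C p q) (phi v) = 0.
  by move=> h; rewrite phiX ?h //; apply: in_osp_F.
have [sA [_ [uA [_ /(@singular_highest _ _ _ _ false)[uA0 uA1 uA2] _]]]] := hLA.
have [_ [_ [uB [_ /(@singular_highest _ _ _ _ true)[uB0 uB1 uB2] _]]]] := hLB.
have uB2' : highest true (phi uB) by move=> p q /uB2; apply: phiz.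
have evenc (V : ospRep C m n) mu : even_constituent V mu ->
    exists v : V, [/\ v != 0, weight_vec mu v & forall d, even_highest d v].
  by case=> I [W [nu [[hW _ _] [i <-]]]];
    have [_ _ [v [_ /singular_even h _]]] := hW i; exists v.
(* The extra sum in the statement exchanges the two Weyl vectors in the [mu] term, so that this term
   uses the adapted system while the scalar uses the other one. *)
have swap (mu : 'rV[C]_(m./2 + n)) : wform (mu + 2 *: rho (odd_pos C m n false)) mu =
   wform (mu + 2 *: rho (odd_pos C m n true)) mu
   + 2 * \sum_(i < m./2) \sum_(a < n) wform mu (epsw C n i - deltaw C m a).
  rewrite /odd_pos rho_AB scalerDr addrA [LHS]wformDl; congr (_ + _).
  rewrite wformZl wformC wform_sumr; congr (_ * _); apply: eq_bigr => i _.
  by rewrite wform_sumr.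
split=> s hs mu /evenc[v [v0 v1 v2]] rr Q.
  have -> : Q = - (-1) ^+ s * (- wform (Lam' + 2 *: rho (odd_pos C m n true)) Lam'
      + wform (mu + 2 *: rho (odd_pos C m n false)) mu).
    by rewrite swap addrA.
  apply: (dirac_inequality (d := false) sA hunit hs uA0 uA1 uA2 (phi_neq0 _ uB0) (phiw
    _ _ uB1) uB2'
    (phi_neq0 _ v0) (phiw _ _ v1)) => d p q hpq hpar.
  by apply: phiz; apply: v2 hpq hpar.
have -> : Q = - (-1) ^+ s * (- wform (Lam + 2 *: rho (odd_pos C m n false)) Lam
    + wform (mu + 2 *: rho (odd_pos C m n true)) mu).
  by rewrite /Q /rr -[odd_posA C m n]/(odd_pos C m n false) (swap mu) addrA addrK.
exact: (dirac_inequality (d := true) sA hunit hs (phi_neq0 _ uB0) (phiw _ _ uB1) uB2'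
  uA0 uA1 uA2
  v0 v1 v2).
Qed.

Theorem proposition50 (R : realType) (m n : nat) (hm : (1 <= m)%N) (hn : (1 <= n)%N)
  (J : 'M[R[i]]_(m + (n + n))) (hJ : anti_involution_matrix J)
  (LA LB : ospRep R[i] m n) (e : bool) (Lam Lam' : 'rV[R[i]]_(m./2 + n))
  (hLA : simple_highest_weight LA Lam (odd_posA R[i] m n))
  (hLB : simple_highest_weight LB Lam' (odd_posB R[i] m n))
  (hiso : rep_iso LA (if e then parity_rev LB else LB))
  (hunit : unitary (omega J) LA) :
  (forall s : bool, adapted (omega J) (odd_posA R[i] m n) s ->
     forall mu : 'rV[R[i]]_(m./2 + n), even_constituent LB mu ->
       let rhoB := rho (odd_posB R[i] m n) in
       let Q := - (-1) ^+ s *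
         (- wform (Lam' + 2 *: rhoB) Lam' + wform (mu + 2 *: rhoB) mu
          + 2 * \sum_(i < m./2) \sum_(a < n)
                  wform mu (epsw R[i] n i - deltaw R[i] m a)) in
       0 <= Q /\ (mu <> Lam -> 0 < Q))
  /\
  (forall s : bool, adapted (omega J) (odd_posB R[i] m n) s ->
     forall mu : 'rV[R[i]]_(m./2 + n), even_constituent LA mu ->
       let rhoA := rho (odd_posA R[i] m n) in
       let Q := - (-1) ^+ s *
         (- wform (Lam + 2 *: rhoA) Lam + wform (mu + 2 *: rhoA) mu
          - 2 * \sum_(i < m./2) \sum_(a < n)
                  wform mu (epsw R[i] n i - deltaw R[i] m a)) in
       0 <= Q /\ (mu <> Lam' -> 0 < Q)).
Proof. exact: even_constituent_inequality hLA hLB hiso hunit. Qed.
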